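(* Let $r\geq 2$ and let $F_1,\dotsc,F_r$ be graphs with $m_2(F_1)\geq \dotsb\geq m_2(F_r)$ and $m_2(F_2)\geq 1$. Then there exists a positive constant $K$ such that if $p=p(n)\geq K n^{-1/m_2(F_1,F_2)}$, then \[ \lim_{n\to\infty}\Pr\big(G(n,p)\to(F_1,\dotsc,F_r)\big)=1. \]
   Context: $G(n,p)$ is the binomial random graph on $n$ vertices in which each edge is present independently with probability $p$. For a graph $G$ and graphs $F_1,\dotsc,F_r$, we write $G\to(F_1,\dotsc,F_r)$ if for every colouring of the edges of $G$ with colours from $\{1,\dotsc,r\}$ there is some $i$ and a copy of $F_i$ in $G$ all of whose edges have colour $i$. A graph is nonempty if it has at least one edge; $v_F$ and $e_F$ denote the numbers of vertices and edges of $F$. For a nonempty graph $F$, let $d_2(F):=1/2$ if $F=K_2$ and $d_2(F):=\frac{e_F-1}{v_F-2}$ otherwise, and define the $2$-density $m_2(F):=\max\{d_2(F'):F'\subseteq F,\ e_{F'}\geq 1\}$. For nonempty graphs $F_1,F_2$ with $m_2(F_1)\geq m_2(F_2)$, define the asymmetric $2$-density \[ m_2(F_1,F_2):=\max\left\{\frac{e_{F_1'}}{v_{F_1'}-2+1/m_2(F_2)}: F_1'\subseteq F_1,\ e_{F_1'}\geq 1\right\}. \] *)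

(* Defs.v *)
From HB Require Import structures.
From mathcomp Require Import all_boot all_order all_algebra.
From mathcomp Require Import all_reals.

Set Implicit Arguments.
Unset Strict Implicit.
Unset Printing Implicit Defensive.

Import Order.TTheory GRing.Theory Num.Theory.

Local Open Scope ring_scope.

(* A finite simple graph is a vertex set inside an ambient finite type T,
   together with a set of 2-element subsets of it.  The ambient type allows
   subgraphs of F to live in the same type as F. *)
Record sgraph (T : finType) := SGraph {
  sgval : {set T} * {set {set T}};
  _ : [forall e in sgval.2, (#|e| == 2%N) && (e \subset sgval.1)]
}.

HB.instance Definition _ (T : finType) := [isSub for @sgval T].
HB.instance Definition _ (T : finType) := [Finite of sgraph T by <:].

Section Graphs.
Variable T : finType.
Implicit Types F G H : sgraph T.

Definition verts G : {set T} := (sgval G).1.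
Definition edges G : {set {set T}} := (sgval G).2.

Definition has_edge G : bool := edges G != set0.

Definition subgraph H F : bool :=
  (verts H \subset verts F) && (edges H \subset edges F).

End Graphs.

Section Densities.
Variable R : realType.

(* For simple graphs, having 2 vertices and 1 edge characterises K_2. *)
Definition d2 (T : finType) (F : sgraph T) : R :=
  if (#|verts F| == 2%N) && (#|edges F| == 1%N) then 1 / 2
  else (#|edges F|%:R - 1) / (#|verts F|%:R - 2).

(* In m2 and m2asym, the base value 0 of the maximum is harmless: when F
   (resp. F1 and F2) is nonempty, the maximum ranges over a nonempty family of
   nonnegative numbers. *)
Definition m2 (T : finType) (F : sgraph T) : R :=
  \big[Num.max/0]_(H : sgraph T | subgraph H F && has_edge H) d2 H.

Definition m2asym (T1 T2 : finType) (F1 : sgraph T1) (F2 : sgraph T2) : R :=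
  \big[Num.max/0]_(H : sgraph T1 | subgraph H F1 && has_edge H)
    (#|edges H|%:R / (#|verts H|%:R - 2 + 1 / m2 F2)).

End Densities.

(* f exhibits a (not necessarily induced) copy of F in G all of whose edges
   have colour i under c. *)
Definition mono_copy (S T : finType) (F : sgraph S) (G : sgraph T) (r : nat)
    (c : {ffun {set T} -> 'I_r}) (i : 'I_r) (f : {ffun S -> T}) : bool :=
  [&& [forall x in verts F, f x \in verts G],
      [forall x in verts F, forall y in verts F, (f x == f y) ==> (x == y)] &
      [forall e in edges F, (f @: e \in edges G) && (c (f @: e) == i)]].

(* G -> (F_1, ..., F_r).  Colourings are total functions on {set T}; only
   their values on the edges of G matter. *)
Definition arrows (T : finType) (G : sgraph T) (r : nat)
    (V : 'I_r -> finType) (F : forall i : 'I_r, sgraph (V i)) : bool :=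
  [forall c : {ffun {set T} -> 'I_r},
    [exists i : 'I_r, [exists f : {ffun V i -> T}, mono_copy (F i) G c i f]]].

(* The probability that the binomial random graph G(n,p), whose vertex set is
   all of 'I_n, satisfies A. *)
Definition gnp_prob (R : realType) (n : nat) (p : R)
    (A : pred (sgraph 'I_n)) : R :=
  \sum_(G : sgraph 'I_n | (verts G == [set: 'I_n]) && A G)
    \prod_(e : {set 'I_n} | #|e| == 2%N) (if e \in edges G then p else 1 - p).

(* Main.v *)
Require Import Defs.
From mathcomp Require Import all_boot all_order all_algebra.
From mathcomp Require Import zify ring lra.
From mathcomp Require Import boolp all_reals sequences exp.

(* Let theta = 1 / m_2(F_2). If a colouring of G = G(n,p) has no copy of F_i in
   colour i for i >= 2, then every subgraph of the i-th colour class lies in a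
   container that spans at most eps n^(v(F_i)) copies of F_i and is determined
   by a fingerprint of O(n^(2-theta)) edges of this subgraph. By Ramsey's
   theorem, the complement of the union of the containers spans a positive
   proportion of all copies of F_1. A union bound over arbitrary fingerprints
   would lose a logarithm, as p may be much larger than n^(-theta). Instead,
   keep every copy of F_1 in K_n independently with a probability q for which
   the expected number mu of kept copies contained in G is a large multiple of
   n^(2-theta). The definition of m_2(F_1,F_2) implies that most of these are
   edge-disjoint from the others, so that by the Efron-Stein inequality G
   contains, with high probability, a family of (1-e) mu pairwise edge-disjoint
   kept copies, where e is a small constant. If there is no copy of F_1 in
   colour 1, every member of this family has an edge of colour at least 2. The
   containers are applied to one such edge of each member, so that a fingerprint
   is encoded by a subfamily of O(n^(2-theta)) << mu edge-disjoint copies, and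
   all members avoid a positive proportion of the copies of F_1. For
   edge-disjoint copies this is exponentially unlikely, by a first moment
   computation that also pays for the choice of the subfamily. *)

Set Implicit Arguments.
Unset Strict Implicit.
Unset Printing Implicit Defensive.

Import Order.TTheory GRing.Theory Num.Theory.

(** * Ramsey's theorem and supersaturation *)

(** Induction on the sum of the [k i]: some colour class at a vertex [v] reaches the bound for [k]
    lowered by one in that colour, and [v] is added if the clique found there has that colour. *)
Lemma ramsey (r : nat) (k : 'I_r -> nat) :
  exists M : nat, forall (T : finType) (c : {set T} -> 'I_r) (A : {set T}),
    M <= #|A| ->
    exists i (B : {set T}), [/\ B \subset A, #|B| = k i &
      forall x y, x \in B -> y \in B -> x != y -> c [set x; y] = i].
Proof.
have [s] := ubnP (\sum_i k i); elim: s k => // s IHs k ltks.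
have [/existsP[i /eqP ki0]|] := boolP [exists i, k i == 0].
  exists 0 => T c A _; exists i, set0.
  by split; [exact: sub0set | rewrite cards0 |move=> x y; rewrite inE].
rewrite negb_exists => /forallP kpos.
have {}kpos i : 0 < k i by rewrite lt0n.
pose k' i j := k j - (j == i).
have /fin_all_exists[M HM] i : exists M : nat,
    forall (T : finType) (c : {set T} -> 'I_r) (A : {set T}), M <= #|A| ->
    exists j (B : {set T}), [/\ B \subset A, #|B| = k' i j &
      forall x y, x \in B -> y \in B -> x != y -> c [set x; y] = j].
  apply: IHs; rewrite ltnS in ltks; apply: leq_trans ltks.
  rewrite (bigD1 i) //= [X in _ < X](bigD1 i) //= /k' eqxx subn1 -addSn prednK //.
  by rewrite leq_add2l leq_sum // => j _; rewrite leq_subr.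
exists (\sum_i M i).+1 => T c A ltA.
have /card_gt0P[v vA] : 0 < #|A| by exact: leq_ltn_trans ltA.
pose N i := [set x in A :\ v | c [set v; x] == i].
have sumN : \sum_i #|N i| = #|A :\ v|.
  rewrite -sum1_card (partition_big (fun x => c [set v; x]) xpredT) //=.
  apply: eq_bigr => i _; rewrite -sum1_card; apply: eq_bigl => x.
  by rewrite !inE.
have [/existsP[i leMi]|] := boolP [exists i, M i <= #|N i|]; last first.
  rewrite negb_exists => /forallP ltN; move: ltA.
  rewrite (cardsD1 v) vA add1n ltnS -sumN leqNgt.
  (* Any value of [c] shows that there is a colour, so that summing the strict inequalities gives a
     strict one. *)
  have i0 : 'I_r := c set0.
  rewrite ltn_neqAle leq_sum ?andbT => [|i _]; last first.
    by rewrite ltnW // ltnNge.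
  case: eqP => //= e _.
  have := ltN i0; rewrite -ltnNge => lt0.
  have : \sum_(i < r) #|N i| < \sum_(i < r) M i.
    rewrite (bigD1 i0) //= [X in _ < X](bigD1 i0) //= -addSn leq_add //.
    by apply: leq_sum => i _; rewrite ltnW // ltnNge.
  by rewrite e ltnn.
have [j [B [BN cB cc]]] := HM i T c (N i) leMi.
have BA : B \subset A.
  by apply: subset_trans BN _; apply/subsetP => x; rewrite !inE => /andP[/andP[]].
have vB : v \notin B.
  by apply/negP => /(subsetP BN); rewrite !inE eqxx.
have [ji|ji] := eqVneq j i; last first.
  by exists j, B; split=> //; rewrite cB /k' (negbTE ji) subn0.
subst j; exists i, (v |: B); split.
- by rewrite subUset sub1set vA.
- by rewrite cardsU1 vB cB /k' eqxx subn1 add1n prednK.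
- move=> x y; rewrite !inE => /orP[/eqP->|xB] /orP[/eqP->|yB] xy.
  + by rewrite eqxx in xy.
  + by move/(subsetP BN): yB; rewrite !inE => /andP[_ /eqP].
  + by move/(subsetP BN): xB; rewrite !inE setUC => /andP[_ /eqP].
  + exact: cc.
Qed.

(** Copies are labelled, and the injection is defined on all of [S]: vertices outside [cover E] are
    placed too, and counts are compared with [n ^ #|S|]. *)
Definition copies (S T : finType) (E : {set {set S}}) (C : {set {set T}}) :
    {set {ffun S -> T}} :=
  [set f : {ffun S -> T} | injectiveb f && [forall e in E, f @: e \in C]].

Lemma leq_card_bigcup (I T : finType) (P : pred I) (A : I -> {set T}) :
  #|\bigcup_(i | P i) A i| <= \sum_(i | P i) #|A i|.
Proof.
elim/big_rec2: _ => [|i m B _ IH]; first by rewrite cards0.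
by rewrite (leq_trans (leq_card_setU _ _)) // leq_add2l.
Qed.

(** The map [g] is determined by its composite with [f] and its values off the range of [f]. *)
Lemma card_ffun_precomp (S D T : finType) (f : S -> D) (X : {set {ffun S -> T}}) :
  injective f ->
  #|[set g : {ffun D -> T} | [ffun x => g (f x)] \in X]| <=
    #|X| * #|T| ^ (#|D| - #|S|).
Proof.
move=> finj.
pose C := {y : D | y \notin codom f}.
pose h (g : {ffun D -> T}) : {ffun S -> T} * {ffun C -> T} :=
  ([ffun x => g (f x)], [ffun y => g (val y)]).
have hinj : injective h.
  move=> g1 g2 [/ffunP e1 /ffunP e2]; apply/ffunP => y.
  have [/codomP[x ->]|yf] := boolP (y \in codom f).
    by have := e1 x; rewrite !ffunE.
  by have := e2 (Sub y yf); rewrite !ffunE.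
rewrite -(card_imset _ hinj).
have -> : #|X| * #|T| ^ (#|D| - #|S|) = #|setX X [set: {ffun C -> T}]|.
  rewrite cardsX cardsT card_ffun; congr (_ * _ ^ _).
  rewrite card_sig -(card_codom finj) -(cardC (mem (codom f))) addKn.
  exact: eq_card.
apply: subset_leq_card; apply/subsetP => _ /imsetP[g gX ->].
by rewrite inE in_setT andbT; rewrite inE in gX.
Qed.

(** Each injection of ['I_M] into ['I_n] pulls the colouring back to ['I_M], where Ramsey's theorem
    yields a monochromatic clique of size [#|S i|], hence a copy through some [f : S i -> 'I_M].
    There are at most [M ^ #|S i|] such [f], and for each of them a copy extends in at most
    [n ^ (M - #|S i|)] ways. *)
Lemma count_mono_copies (r : nat) (S : 'I_r -> finType)
    (E : forall i, {set {set S i}}) (E2 : forall i e, e \in E i -> #|e| = 2) :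
  exists M : nat, (forall i, #|S i| <= M) /\
    forall n (c : {set 'I_n} -> 'I_r),
    n ^_ M <= \sum_i #|copies (E i) [set e | c e == i]| *
                     (M ^ #|S i| * n ^ (M - #|S i|)).
Proof.
have [M0 HM0] := @ramsey r (fun i => #|S i|).
pose M := M0 + \max_i #|S i|.
have SM i : #|S i| <= M.
  by apply: leq_trans (leq_addl _ _); exact: (@leq_bigmax _ (fun i => #|S i|)).
exists M; split=> // n c.
pose X i := copies (E i) [set e | c e == i].
pose Y i (f : {ffun S i -> 'I_M}) :=
  [set g : {ffun 'I_M -> 'I_n} | [ffun x => g (f x)] \in X i].
have := card_inj_ffuns 'I_M 'I_n; rewrite !card_ord => <-.
have sub : [set f : {ffun 'I_M -> 'I_n} | injectiveb f] \subset
    \bigcup_i \bigcup_(f : {ffun S i -> 'I_M} | injectiveb f) Y i f.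
  apply/subsetP => g; rewrite inE => /injectiveP ginj.
  have [|i [B [_ cB cc]]] := HM0 _ (fun s : {set 'I_M} => c (g @: s)) setT.
    by rewrite cardsT card_ord leq_addr.
  pose f := [ffun x : S i => enum_val (cast_ord (esym cB) (enum_rank x))].
  have finj : injective f.
    move=> x y; rewrite !ffunE => /enum_val_inj /cast_ord_inj.
    exact: enum_rank_inj.
  have fB x : f x \in B by rewrite ffunE enum_valP.
  clearbody f.
  apply/bigcupP; exists i => //; apply/bigcupP; exists f; first exact/injectiveP.
  rewrite !inE; apply/andP; split.
    by apply/injectiveP => x y; rewrite !ffunE => /ginj /finj.
  apply/forall_inP => e eE; rewrite inE.
  have /eqP/cards2P[x [y [xy ->]]] := E2 i e eE.
  have := cc (f x) (f y) (fB x) (fB y); rewrite (inj_eq finj) => /(_ xy) cxy.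
  by apply/eqP; rewrite -[RHS]cxy !imsetU1 !imset_set1 !ffunE.
apply: leq_trans (subset_leq_card sub) _.
apply: leq_trans (leq_card_bigcup _ _) _.
apply: leq_sum => i _.
apply: leq_trans (leq_card_bigcup _ _) _.
apply: (@leq_trans (\sum_(f : {ffun S i -> 'I_M}) #|X i| * n ^ (M - #|S i|))).
  rewrite big_mkcond; apply: leq_sum => f _; case: ifP => // /injectiveP finj.
  have := card_ffun_precomp (X i) finj.
  by rewrite !card_ord.
by rewrite sum_nat_const card_ffun card_ord mulnCA.
Qed.

Local Open Scope ring_scope.

Lemma copiesS (S T : finType) (E : {set {set S}}) (C C' : {set {set T}}) :
  C \subset C' -> copies E C \subset copies E C'.
Proof.
move=> /subsetP CC; apply/subsetP => f; rewrite !inE => /andP[-> /forall_inP fC].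
by apply/forall_inP => e /fC /CC.
Qed.

Lemma expn_le_ffact (n M : nat) : (M.*2 <= n)%N -> (n ^ M <= 2 ^ M * n ^_ M)%N.
Proof.
move=> Mn; rewrite ffact_prod -{2}[M]card_ord -prod_nat_const -big_split /=.
rewrite -{1}[M]card_ord -prod_nat_const.
apply: leq_prod => i _; have := ltn_ord i; lia.
Qed.

(** Colour an edge by some [i] other than [i0] whose [C i] contains it, and by [i0] if there is
    none. The normalised and weighted copy counts of [count_mono_copies] sum to at least [a];
    colours other than [i0] contribute at most [a / 2], so [i0] contributes the rest. *)
Lemma supersaturation (R : realFieldType) (r : nat) (S : 'I_r -> finType)
    (E : forall i, {set {set S i}}) (E2 : forall i e, e \in E i -> #|e| = 2%N)
    (i0 : 'I_r) :
  exists eps zeta : R, exists n0 : nat, [/\ 0 < eps, 0 < zeta & forall n, (n0 <= n)%N ->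
    forall C : 'I_r -> {set {set 'I_n}},
    (forall i, i != i0 -> #|copies (E i) (C i)|%:R <= eps * n%:R ^+ #|S i|) ->
    zeta * n%:R ^+ #|S i0| <=
      #|copies (E i0) [set e | [forall i, (i != i0) ==> (e \notin C i)]]|%:R].
Proof.
have [M [SM HM]] := count_mono_copies E2.
(* [B] dominates the weights [M ^ #|S i|] and their sum; [a] is the lower bound for [n ^_ M / n ^ M]
   from [expn_le_ffact]. *)
pose B : R := \sum_i M%:R ^+ #|S i| + 1.
have B0 : 0 < B by rewrite ltr_wpDl // sumr_ge0 // => i _; rewrite exprn_ge0.
pose a : R := 2^-1 ^+ M.
have a0 : 0 < a by rewrite exprn_gt0 ?invr_gt0.
have ab0 : 0 < a / (2 * B) by rewrite divr_gt0 // mulr_gt0.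
exists (a / (2 * B)), (a / (2 * B)), (M.*2).+1.
split=> // n n0 C HC.
pose c (e : {set 'I_n}) := odflt i0 [pick i | (i != i0) && (e \in C i)].
have Mn : (M.*2 <= n)%N by exact: ltnW.
have n_gt0 : 0 < n%:R :> R by rewrite ltr0n; exact: leq_ltn_trans n0.
have := HM n c; rewrite -(ler_nat R) => Hc.
pose X i : R := #|copies (E i) [set e | c e == i]|%:R.
have le1 : a <= \sum_i X i * M%:R ^+ #|S i| / n%:R ^+ #|S i|.
  have := expn_le_ffact Mn; rewrite -(ler_nat R) natrM !natrX => Hn.
  rewrite -(ler_pM2r (exprn_gt0 M n_gt0)).
  apply: (@le_trans _ _ ((n ^_ M)%:R)).
    rewrite /a exprVn mulrC ler_pdivrMr ?exprn_gt0 // mulrC //.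
  apply: le_trans Hc _; rewrite natr_sum mulr_suml; apply: ler_sum => i _.
  rewrite !natrM !natrX -(subnK (SM i)) addnK exprD.
  rewrite -/(X i) le_eqVlt; apply/orP; left; apply/eqP.
  by field; rewrite expf_neq0 // gt_eqF.
have Xsub i : i != i0 -> X i <= a / (2 * B) * n%:R ^+ #|S i|.
  move=> ii0; apply: le_trans (HC _ ii0); rewrite ler_nat subset_leq_card //.
  apply: copiesS; apply/subsetP => e; rewrite !inE /c.
  case: (pickP (fun i => (i != i0) && (e \in C i))) => [j /andP[_ ej] /eqP <- //|_].
  by rewrite eq_sym (negbTE ii0).
have X0 : X i0 <= #|copies (E i0) [set e | [forall i, (i != i0) ==> (e \notin C i)]]|%:R.
  rewrite ler_nat subset_leq_card //.
  apply: copiesS; apply/subsetP => e; rewrite !inE /c.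
  case: (pickP (fun i => (i != i0) && (e \in C i))) => [j /andP[/negbTE ji _]/=|ne _]; first by rewrite ji.
  apply/forall_inP => i ii0; have := ne i; rewrite ii0 /= => -> //.
apply: le_trans X0.
rewrite -ler_pdivlMr ?exprn_gt0 //.
have Mi i : M%:R ^+ #|S i| <= B :> R.
  rewrite /B (bigD1 i) //= -addrA lerDl addr_ge0 // sumr_ge0 // => j _.
  by rewrite exprn_ge0.
have : a <= X i0 / n%:R ^+ #|S i0| * B + a / 2.
  apply: le_trans le1 _; rewrite (bigD1 i0) //=; apply: lerD.
    rewrite mulrAC ler_wpM2l //; rewrite divr_ge0 // ?exprn_ge0 // ltW //.
  apply: (@le_trans _ _ (\sum_(i < r | i != i0) a / (2 * B) * M%:R ^+ #|S i|)).
    apply: ler_sum => i ii0; rewrite mulrAC ler_wpM2r ?exprn_ge0 //.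
    by rewrite ler_pdivrMr ?exprn_gt0 // Xsub.
  rewrite -mulr_sumr invfM mulrA -mulrA -[leRHS]mulr1.
  rewrite ler_wpM2l ?divr_ge0 //; first exact: ltW.
  rewrite mulrC ler_pdivrMr // mul1r /B [X in _ <= X + _](bigD1 i0) //=.
  by rewrite -addrA addrCA lerDl addr_ge0 // exprn_ge0.
move=> Ha.
rewrite invfM mulrA ler_pdivrMr //. lra.
Qed.

(** * Hypergraph containers *)

(* T I is a fingerprint of I: the datum g I can be recovered from T I, as
   g I = g (T I). *)
Definition fingerprint (V : finType) (X : Type) (T : {set V} -> {set V})
    (g : {set V} -> X) :=
  (forall I, T I \subset I) /\
  (forall I I' : {set V}, T I \subset I' -> I' \subset I -> T I' = T I /\ g I' = g I).

Section Fingerprint.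
Variable V : finType.

Lemma fingerprint_cst X (x : X) : @fingerprint V X (fun=> set0) (fun=> x).
Proof. by split=> // I; exact: sub0set. Qed.

(** The second stage may depend on the datum of the first: a subset of [I] containing both
    fingerprints first recovers [g1 I], and with it the second stage. *)
Lemma fingerprint_comp X Y (T1 : {set V} -> {set V}) (g1 : {set V} -> X)
    (T2 : X -> {set V} -> {set V}) (g2 : X -> {set V} -> Y) :
  fingerprint T1 g1 -> (forall x, fingerprint (T2 x) (g2 x)) ->
  fingerprint (fun I => T1 I :|: T2 (g1 I) I) (fun I => g2 (g1 I) I).
Proof.
move=> [T1I T1s] fp2; split=> [I|I I'].
  by rewrite subUset T1I; have [-> _] := fp2 (g1 I).
rewrite subUset => /andP[T1I' T2I'] I'I.
have [-> ->] := T1s I I' T1I' I'I.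
by have [_ /(_ I I' T2I' I'I)[-> ->]] := fp2 (g1 I).
Qed.

Lemma ohead_filterW (U : Type) (p q : pred U) (s : seq U) :
  {subset q <= p} -> (forall v, ohead (filter p s) = Some v -> q v) ->
  ohead (filter q s) = ohead (filter p s).
Proof.
move=> qp; elim: s => //= x s IHs; case: ifP => px /= Hq.
  by rewrite Hq.
by case: ifP => [qx|_]; [have := qp x qx; rewrite unfold_in px | exact: IHs].
Qed.

(** The canonical choice survives shrinking the pool as long as the chosen element stays. This makes
    the algorithm reproducible from its fingerprint. *)
Lemma pickW (p q : pred V) :
  {subset q <= p} -> (forall v, pick p = Some v -> q v) -> pick q = pick p.
Proof. by rewrite /pick /enum_mem => qp Hp; apply: ohead_filterW. Qed.

Variable X : Type.
Variables (Q : X -> {set V}) (u : X -> V -> X).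

Definition query x (I : {set V}) : option V := [pick v in I :&: Q x].

Fixpoint run m x (I : {set V}) : {set V} * X :=
  if m is m'.+1 then
    if query x I is Some v then
      let: (T, y) := run m' (u x v) I in (v |: T, y)
    else (set0, x)
  else (set0, x).

(** The state changes only through vertices put into the fingerprint, and by [pickW] each query has
    the same answer on every set between the fingerprint and [I]. *)
Lemma run_fingerprint m x :
  fingerprint (fun I => (run m x I).1) (fun I => (run m x I).2).
Proof.
elim: m x => [|m IHm] x; first exact: fingerprint_cst.
split=> [I|I I'] /=.
  rewrite /query; case: pickP => [v|_]; last exact: sub0set.
  rewrite inE => /andP[vI _]; have [/(_ I)] := IHm (u x v).
  by case: (run m (u x v) I) => T y /= TI _; rewrite subUset sub1set vI.
move=> TI' I'I.
have qE : query x I' = query x I.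
  apply: pickW => v; first by rewrite !inE => /andP[/(subsetP I'I) -> ->].
  move=> qv; move: (qv) TI'; rewrite /query => ->.
  move: qv; rewrite /query; case: pickP => // w; rewrite inE => /andP[_ wQ] [<-].
  case: (run m _ I) => T y /=; rewrite subUset sub1set => /andP[wI' _].
  by rewrite inE wI'.
rewrite qE; case: (query x I) TI' => [v|] //.
have [_ /(_ I I')] := IHm (u x v).
case: (run m _ I) => T y /=; case: (run m _ I') => T' y' /= IH.
by rewrite subUset => /andP[_ /IH] /(_ I'I)[-> ->].
Qed.

Lemma run_card m x I : (#|(run m x I).1| <= m)%N.
Proof.
elim: m x => [|m IHm] x /=; first by rewrite cards0.
case: (query x I) => [v|]; last by rewrite cards0.
have := IHm (u x v); case: (run _ _ _) => T y /= Tm.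
by rewrite (leq_trans (leq_card_setU _ _)) // cards1 add1n ltnS.
Qed.

(** The two ways in which a run ends are the two cases of the container argument: [m] picks were
    made, or [I] avoids all current candidates, which can then be left out of the container. *)
Lemma run_ind (P : nat -> X -> Prop) (I : {set V}) m x :
  P 0%N x ->
  (forall k y v, P k y -> v \in I -> v \in Q y -> P k.+1 (u y v)) ->
  exists2 k, P k (run m x I).2 & k = m \/ [disjoint I & Q (run m x I).2].
Proof.
move=> P0 PS.
suff /(_ 0%N) H : forall k, P k x -> exists2 k', P k' (run m x I).2 &
    (k' = k + m)%N \/ [disjoint I & Q (run m x I).2].
  by have [k Pk Hk] := H P0; exists k.
elim: m x {P0} => [|m IHm] x k Pk /=; first by exists k; rewrite ?addn0 //; left.
rewrite /query; case: pickP => [v|H].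
  rewrite inE => /andP[vI vQ].
  have := IHm (u x v) k.+1 (PS _ _ _ Pk vI vQ).
  by case: (run _ _ _) => T y /= [k' Pk' H]; exists k'; rewrite // addnS -addSn.
exists k => //; right; apply/pred0P => v; have := H v.
by rewrite inE.
Qed.

End Fingerprint.

(** Hyperedges are indexed by [J] and may coincide as sets: later [J] is a type of embeddings, and
    different embeddings can have the same image. *)
Definition hdeg (V J : finType) (E : J -> {set V}) (A : {set J}) (S : {set V}) :=
  #|[set j in A | S \subset E j]|.

Definition independent (V J : finType) (E : J -> {set V}) (A : {set J})
    (I : {set V}) := [forall j in A, ~~ (E j \subset I)].

(** The codegree condition of the container method; for singletons it makes [D] a bound on the
    vertex degrees. *)
Definition spread (R : realType) (V J : finType) (E : J -> {set V})
    (A : {set J}) (D tau : R) :=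
  forall S, S != set0 -> (hdeg E A S)%:R <= D * tau ^+ #|S|.-1.

(** * One step of the container algorithm, from uniformity [s.+1] to [s] *)

Section ContainerStep.
Variables (R : realType) (V J : finType) (E : J -> {set V}) (A : {set J}).
Variables (X : {set V}) (s : nat) (alpha N D tau : R).
Hypotheses (alpha0 : 0 < alpha) (D0 : 0 < D) (tau0 : 0 < tau) (tau1 : tau <= 1).
Hypotheses (AX : forall j, j \in A -> E j \subset X) (XN : #|X|%:R <= N) (NT : 1 <= N * tau).
Hypotheses (Es : forall j, j \in A -> #|E j| = s.+1).
Hypotheses (EA : spread E A D tau) (AN : alpha * N * D <= #|A|%:R).

(* sg j = Some v records that the edge j was used when the vertex v was picked;
   it then contributes the edge E j :\ v to the hypergraph of uniformity s. *)
Implicit Types sg : {ffun J -> option V}.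

Definition used sg := [set j in A | sg j != None].
Definition link sg j := if sg j is Some v then E j :\ v else E j.
(* Discarding the edges of A that contain a saturated set keeps the degrees of
   the link hypergraph below 2 * D * tau ^+ #|S|. *)
Definition saturated sg S :=
  (S != set0) && (D * tau ^+ #|S| <= (hdeg (link sg) (used sg) S)%:R).
Definition remaining sg :=
  [set j in A | (sg j == None) && [forall S : {set V}, (S \subset E j) ==> ~~ saturated sg S]].
(** The power of 2 absorbs the [2 ^+ s] subsets of each link counted in [card_nsat] and still leaves
    a factor 1/4. *)
Definition used_density := alpha / 2 ^+ s.+2.
Definition threshold := alpha / 4 * D.
(** Emptying this set once enough hyperedges are used makes the run stop. *)
Definition candidates sg :=
  if #|used sg|%:R < used_density * N * D * tau then
    [set v | threshold <= (hdeg E (remaining sg) [set v])%:R] else set0.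
Definition pick_vertex sg v : {ffun J -> option V} :=
  [ffun j => if (j \in remaining sg) && (v \in E j) then Some v else sg j].

Let thr0 : 0 < threshold. Proof. by rewrite mulr_gt0 // divr_gt0. Qed.
Let N0 : 0 < N.
Proof. by rewrite -(pmulr_lgt0 _ tau0); apply: lt_le_trans NT. Qed.
Let used_density0 : 0 < used_density. Proof. by rewrite divr_gt0 // exprn_gt0. Qed.

Lemma used_pick sg v :
  used (pick_vertex sg v) = used sg :|: [set j in remaining sg | v \in E j].
Proof.
apply/setP => j; rewrite !inE ffunE !inE.
case: (j \in A) => //=; case: (sg j) => [w|] //=; case: (v \in E j); rewrite ?andbT ?andbF //=.
by case: ifP.
Qed.

Lemma card_used_pick sg v : v \in candidates sg ->
  #|used sg|%:R + threshold <= #|used (pick_vertex sg v)|%:R.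
Proof.
rewrite /candidates; case: ifP => _; last by rewrite inE.
rewrite inE => thrv; rewrite used_pick cardsU disjoint_setI0.
  rewrite cards0 subn0 natrD lerD2l; apply: le_trans thrv _; rewrite ler_nat.
  by apply: subset_leq_card; apply/subsetP => j; rewrite !inE sub1set.
rewrite -setI_eq0; apply/eqP/setP => j; rewrite !inE.
by case: (sg j) => [a|] //=; rewrite ?andbF.
Qed.

Lemma link_pick sg v (S : {set V}) j :
  (j \in used (pick_vertex sg v)) && (S \subset link (pick_vertex sg v) j) ->
  (j \in used sg) && (S \subset link sg j) \/
  [/\ j \in A, S \subset E j :\ v, v \in E j & forall S : {set V}, S \subset E j -> ~~ saturated sg S].
Proof.
rewrite used_pick inE /link ffunE [j \in [set _ in _ | _]]inE.
have [/andP[jr vE]|nr] := boolP ((j \in remaining sg) && (v \in E j)).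
  move=> /andP[_ SE]; right; move: jr; rewrite inE => /and3P[jA _ /forallP H].
  by split=> // S'; have := H S'; move/implyP.
by rewrite orbF; left.
Qed.

(** A saturated [S] gains no hyperedge, and neither does an [S] containing [v]. Any other [S] has
    degree below [D * tau ^+ #|S|] and gains at most the codegree of [v |: S] in [A], which obeys
    the same bound. *)
Lemma spread_pick sg v :
  (forall S, S != set0 -> (hdeg (link sg) (used sg) S)%:R <= 2 * D * tau ^+ #|S|) ->
  forall S, S != set0 ->
  (hdeg (link (pick_vertex sg v)) (used (pick_vertex sg v)) S)%:R <= 2 * D * tau ^+ #|S|.
Proof.
move=> IH S S0; have [sat|nsat] := boolP (saturated sg S).
  apply: le_trans (IH S S0); rewrite ler_nat; apply: subset_leq_card.
  apply/subsetP => j; rewrite inE => /link_pick[H|[_ SE _ /(_ S)]]; first by rewrite inE.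
  by rewrite sat (subset_trans SE (subsetDl _ _)) => /(_ isT).
have {nsat} lt1 : (hdeg (link sg) (used sg) S)%:R < D * tau ^+ #|S|.
  by move: nsat; rewrite /saturated S0 /= -ltNge.
have [vS|vS] := boolP (v \in S).
  apply: le_trans (IH S S0); rewrite ler_nat; apply: subset_leq_card.
  apply/subsetP => j; rewrite inE => /link_pick[H|[_ SE _ _]]; first by rewrite inE.
  by have := subsetP SE v vS; rewrite !inE eqxx.
apply: (@le_trans _ _ ((hdeg (link sg) (used sg) S)%:R + (hdeg E A (v |: S))%:R)).
  rewrite -natrD ler_nat; apply: leq_trans (leq_card_setU _ _).
  apply: subset_leq_card; apply/subsetP => j.
  rewrite inE => /link_pick[H|[jA SE vE _]]; apply/setUP; [left|right].
    by rewrite inE.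
  rewrite inE jA subUset sub1set vE.
  by rewrite (subset_trans SE (subsetDl _ _)).
have := EA (S := v |: S); rewrite cardsU1 vS /= => EvS.
have {}EvS : (hdeg E A (v |: S))%:R <= D * tau ^+ #|S|.
  by apply: EvS; apply/set0Pn; exists v; rewrite setU11.
by rewrite -mulrA mulr2n mulrDl mul1r; apply: lerD => //; exact: ltW.
Qed.

(** Removed vertices lie in [I], so a link contained in [I] would come from a hyperedge contained in
    [I]: independence passes to the link hypergraph. *)
Definition valid sg (I : {set V}) :=
  forall j v, j \in A -> sg j = Some v -> v \in E j /\ v \in I.

Lemma valid_pick sg v (I : {set V}) : v \in I -> valid sg I -> valid (pick_vertex sg v) I.
Proof.
move=> vI Hsg j w jA; rewrite ffunE; case: ifP => [/andP[_ vE] [<-] //|_].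
exact: Hsg.
Qed.

Lemma card_link sg (I : {set V}) j : valid sg I -> j \in used sg -> #|link sg j| = s.
Proof.
move=> Hsg; rewrite inE /link => /andP[jA]; case e: (sg j) => [w|] // _.
have [wE _] := Hsg j w jA e.
by apply/eqP; rewrite -eqSS -(Es jA) [X in _ == X](cardsD1 w) wE.
Qed.

(** Double counting: a saturated [S] has link degree at least [D * tau ^+ #|S|], hence at least
    [tau] times its degree in [A], and a link of size [s] has only [2 ^+ s] subsets. *)
Lemma card_nsat sg (I : {set V}) : valid sg I ->
  tau * #|[set j in A | [exists S : {set V}, (S \subset E j) && saturated sg S]]|%:R <=
    2 ^+ s * #|used sg|%:R.
Proof.
move=> Hsg.
apply: (@le_trans _ _ (tau * \sum_(S | saturated sg S) (hdeg E A S)%:R)).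
  rewrite ler_wpM2l ?(ltW tau0) // -natr_sum ler_nat.
  apply: leq_trans (leq_card_bigcup _ _).
  apply: subset_leq_card; apply/subsetP => j; rewrite inE => /andP[jA /existsP[S /andP[SE sat]]].
  by apply/bigcupP; exists S => //; rewrite inE jA.
rewrite mulr_sumr.
apply: (@le_trans _ _ (\sum_(S | saturated sg S) (hdeg (link sg) (used sg) S)%:R)).
  apply: ler_sum => S /andP[S0]; apply: le_trans.
  have := EA S0; rewrite -(ler_pM2l tau0) => /le_trans; apply.
  rewrite mulrCA -exprS prednK // card_gt0 //.
apply: (@le_trans _ _ (\sum_(S : {set V}) (hdeg (link sg) (used sg) S)%:R)).
  rewrite [leRHS](bigID (saturated sg)) /= lerDl sumr_ge0 // => S _.
rewrite -natr_sum -natrX -natrM ler_nat.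
have -> : (\sum_(S : {set V}) hdeg (link sg) (used sg) S =
    \sum_(S : {set V}) \sum_(j in used sg) (S \subset link sg j))%N.
  apply: eq_bigr => S _; rewrite /hdeg -sum1_card big_mkcond [RHS]big_mkcond; apply: eq_bigr => j _.
  by rewrite [in LHS]inE; case: (j \in used sg); case: (_ \subset _).
rewrite exchange_big /= mulnC -sum_nat_const; apply: leq_sum => j ju.
rewrite -(card_link Hsg ju) -card_powerset -sum1_card [leqRHS]big_mkcond.
by apply: leq_sum => S _; rewrite inE; case: (_ \subset _).
Qed.

(** Of the at least [alpha * N * D] hyperedges, at most [alpha / 4 * N * D] are used and at most as
    many contain a saturated set. *)
Lemma card_remaining sg (I : {set V}) : valid sg I ->
  #|used sg|%:R < used_density * N * D * tau -> alpha / 2 * N * D <= #|remaining sg|%:R.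
Proof.
move=> Hsg ltu.
have cov : (#|A| <= #|used sg| +
   #|[set j in A | [exists S : {set V}, (S \subset E j) && saturated sg S]]| + #|remaining sg|)%N.
  apply: leq_trans (leq_trans (leq_card_setU _ _) (leq_add (leq_card_setU _ _) (leqnn _))).
  apply: subset_leq_card; apply/subsetP => j jA; rewrite !inE jA /=.
  case: (sg j == None) => //=.
  case: (boolP [exists S, _]) => //=; rewrite negb_exists => H.
  apply/forallP => S; apply/implyP => SE; have := forallP H S.
  by rewrite SE.
move: cov; rewrite -(ler_nat R) !natrD => cov.
have nsat := card_nsat Hsg.
set u : R := #|used sg|%:R in nsat cov ltu *.
set b : R := #|[set j in A | _]|%:R in nsat cov.
have b1 : b <= alpha / 4 * N * D.
  rewrite -(ler_pM2l tau0); apply: le_trans nsat _.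
  apply: (@le_trans _ _ (2 ^+ s * (used_density * N * D * tau))).
    by rewrite ler_wpM2l ?exprn_ge0 // ltW.
  rewrite /used_density !exprS le_eqVlt; apply/orP; left; apply/eqP; field.
  by rewrite expf_neq0 // pnatr_eq0.
have u1 : u <= alpha / 4 * N * D.
  apply: le_trans (ltW ltu) _.
  have -> : used_density * N * D * tau = alpha * N * D * (tau / 2 ^+ s.+2) by rewrite /used_density; ring.
  have -> : alpha / 4 * N * D = alpha * N * D * 4^-1 by ring.
  rewrite ler_wpM2l //; first by rewrite ltW // !mulr_gt0.
  rewrite ler_pdivrMr ?exprn_gt0 //.
  apply: le_trans tau1 _; rewrite !exprS; have : 1 <= 2 ^+ s :> R by rewrite exprn_ege1 // ler1n.
  lra.
have := AN; lra.
Qed.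

(** The degrees in [remaining sg] sum to at least [alpha / 2 * N * D]. Vertices below the threshold
    account for at most half of this, and every candidate for at most [D]. *)
Lemma card_candidates sg (I : {set V}) : valid sg I ->
  #|used sg|%:R < used_density * N * D * tau -> alpha / 4 * N <= #|candidates sg|%:R.
Proof.
move=> Hsg ltu; have rem := card_remaining Hsg ltu.
have : #|remaining sg|%:R <= \sum_(v in X) (hdeg E (remaining sg) [set v])%:R :> R.
  rewrite -natr_sum ler_nat.
  apply: leq_trans (leq_card_bigcup _ _); apply: subset_leq_card.
  apply/subsetP => j jr; have jA : j \in A by move: jr; rewrite inE => /andP[].
  have /card_gt0P[v vE] : (0 < #|E j|)%N by rewrite Es.
  by apply/bigcupP; exists v; rewrite ?(subsetP (AX jA)) // inE jr sub1set.
move/(le_trans rem) => {}rem.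
have : \sum_(v in X) (hdeg E (remaining sg) [set v])%:R <= \sum_(v in X) (threshold + (v \in candidates sg)%:R * D) :> R.
  apply: ler_sum => v _; rewrite /candidates ltu inE.
  case: (leP threshold) => [_|/ltW le1]; last by rewrite mul0r addr0.
  apply: le_trans (_ : (hdeg E A [set v])%:R <= _).
    rewrite ler_nat; apply: subset_leq_card; apply/subsetP => j.
    by rewrite !inE => /andP[/andP[->]].
  apply: le_trans (EA _) _; first by apply/set0Pn; exists v; rewrite inE.
  by rewrite cards1 expr0 mulr1 mul1r lerDr ltW.
move/(le_trans rem) => {}rem.
rewrite big_split /= sumr_const -mulr_suml -natr_sum in rem.
have : (\sum_(v in X) (v \in candidates sg))%:R * D <= #|candidates sg|%:R * D.
  rewrite ler_wpM2r ?(ltW D0) // ler_nat -sum1_card [leqLHS]big_mkcond [leqRHS]big_mkcond.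
  by apply: leq_sum => v _; case: (v \in X) => //; case: (v \in _).
have : threshold *+ #|X| <= alpha / 4 * N * D.
  have -> : alpha / 4 * N * D = threshold * N by rewrite /threshold; ring.
  by rewrite -mulr_natr ler_pM2l.
move=> H H'; rewrite -(ler_pM2r D0).
lra.
Qed.

End ContainerStep.

(** Induction on the uniformity. If the run uses many hyperedges, the link hypergraph is dense and
    spread, and the induction hypothesis applies to it. Otherwise [I] avoids the many candidates,
    and their complement is the container. Uniformity 0 is vacuous, since a nonempty [A] then has no
    independent set. The last conclusion keeps the removed vertices inside the hypergraph, so that
    the lemma can be iterated. *)
Lemma container_lemma (R : realType) (s : nat) (alpha : R) : 0 < alpha ->
  exists2 delta : R, 0 < delta &
  forall (V J : finType) (E : J -> {set V}) (A : {set J}) (X : {set V}) (N D tau : R),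
  0 < D -> 0 < tau -> tau <= 1 -> #|X|%:R <= N -> 1 <= N * tau ->
  (forall j, j \in A -> E j \subset X) -> (forall j, j \in A -> #|E j| = s) -> spread E A D tau ->
  alpha * N * D <= #|A|%:R ->
  exists T C : {set V} -> {set V}, fingerprint T C /\ forall I : {set V}, independent E A I ->
    [/\ #|T I|%:R <= 2 * s%:R * (N * tau), I \subset C I,
        delta * N <= #|~: C I|%:R & ~: C I \subset \bigcup_(j in A) E j].
Proof.
elim: s alpha => [|s IHs] alpha alpha0.
  exists 1 => // V J E A X N D tau D0 tau0 tau1 XN NT AX Es EA AN.
  exists (fun=> set0), (fun=> set0); split; first exact: fingerprint_cst.
  move=> I indI.
  have N0 : 0 < N by rewrite -(pmulr_lgt0 _ tau0); apply: lt_le_trans NT.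
  have : 0 < #|A|%:R :> R by apply: lt_le_trans AN; rewrite !mulr_gt0.
  rewrite ltr0n => /card_gt0P[j jA].
  have := forall_inP indI j jA; rewrite (_ : E j = set0) ?sub0set //.
  by apply/eqP; rewrite -cards_eq0 Es.
pose a' : R := used_density s alpha.
have a'0 : 0 < a' by rewrite divr_gt0 // exprn_gt0.
(* The link hypergraph has degree parameter [2 * D * tau], so with [a' * N * D * tau] hyperedges its
   density is [a' / 2]. *)
have [delta delta0 IH] := IHs (a' / 2) (divr_gt0 a'0 (ltr0n R 2)).
exists (Num.min delta (alpha / 4)); first by rewrite lt_min delta0 divr_gt0.
move=> V J E A X N D tau D0 tau0 tau1 XN NT AX Es EA AN.
have N0 : 0 < N by rewrite -(pmulr_lgt0 _ tau0); apply: lt_le_trans NT.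
have NT0 : 0 <= N * tau by rewrite ltW // mulr_gt0.
pose cand := candidates E A s alpha N D tau.
have a'E : a' / 2 * N * (2 * D * tau) = a' * N * D * tau by field.
(* The second phase may depend on [I] only through the state reached, so it is fixed for every state
   in advance; states violating the hypotheses get a trivial pair. *)
have /fin_all_exists[TC HTC] (sg : {ffun J -> option V}) :
  exists TC : ({set V} -> {set V}) * ({set V} -> {set V}),
  fingerprint TC.1 TC.2 /\ forall I : {set V}, independent E A I -> valid E A sg I ->
  (forall S, S != set0 ->
    (hdeg (link E sg) (used A sg) S)%:R <= 2 * D * tau * tau ^+ #|S|.-1) ->
  a' * N * D * tau <= #|used A sg|%:R \/ [disjoint I & cand sg] ->
  [/\ #|TC.1 I|%:R <= 2 * s%:R * (N * tau), I \subset TC.2 I,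
      Num.min delta (alpha / 4) * N <= #|~: TC.2 I|%:R &
      ~: TC.2 I \subset \bigcup_(j in A) E j].
  have [ltu|leu] := ltP (#|used A sg|%:R) (a' * N * D * tau).
    exists (fun=> set0, fun=> ~: cand sg); split; first exact: fingerprint_cst.
    move=> I _ Hv _ [//|disj].
    rewrite disjoints_subset in disj.
    rewrite /= cards0 setCK; split=> //; first by rewrite !mulr_ge0 ?ler0n ?ltW.
      have := card_candidates alpha0 D0 tau0 tau1 AX XN NT Es EA AN Hv ltu.
      by apply: le_trans; rewrite ler_pM2r // ge_min lexx orbT.
    apply/subsetP => v; rewrite /cand /candidates ltu inE => lt.
    have : 0 < (hdeg E (remaining E A D tau sg) [set v])%:R :> R.
      by apply: lt_le_trans lt; rewrite mulr_gt0 // divr_gt0.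
    rewrite ltr0n => /card_gt0P[j]; rewrite 2!inE sub1set => /andP[/andP[jA _] vE].
    by apply/bigcupP; exists j.
  pose cond := (forall j, j \in used A sg -> #|link E sg j| = s) /\
     spread (link E sg) (used A sg) (2 * D * tau) tau.
  have [[c1 c2]|ncond] := pselect cond; last first.
    exists (fun=> set0, fun=> set0); split; first exact: fingerprint_cst.
    move=> I _ Hv sp _; case: ncond; split=> [j ju|]; last exact: sp.
    exact: (card_link Es Hv ju).
  have linkX j : j \in used A sg -> link E sg j \subset X.
    rewrite inE => /andP[jA _]; apply: subset_trans (AX j jA).
    by rewrite /link; case: (sg j) => [v|] //; exact: subsetDl.
  have := IH V J (link E sg) (used A sg) X N (2 * D * tau) tau.
  rewrite a'E => /(_ _ _ _ _ _ linkX c1 c2 leu)[||//|//|//|T [C [fp H]]] //.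
    by rewrite !mulr_gt0.
  exists (T, C); split=> // I indI Hv _ _ /=.
  have : independent (link E sg) (used A sg) I.
    apply/forall_inP => j ju; move: (ju); rewrite inE /link => /andP[jA].
    case e: (sg j) => [v|] // _; have [vE vI] := Hv j v jA e.
    apply: contra (forall_inP indI j jA) => sub.
    by rewrite -(setD1K vE) subUset sub1set vI.
  move=> /H[H1 H2 H3 H4]; split=> //.
    by apply: le_trans H3; rewrite ler_pM2r // ge_min lexx.
  apply: subset_trans H4 _; apply/bigcupsP => j ju.
  have jA : j \in A by move: ju; rewrite inE => /andP[].
  apply: subset_trans (bigcup_sup _ jA).
  by rewrite /link; case: (sg j) => [v|] //; exact: subsetDl.
(* Making all [m] picks uses at least [N * tau * threshold alpha D] hyperedges, which reaches the
   used density. As [1 <= N * tau], [m] is at most [2 * (N * tau)], the increment of the fingerprint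
   bound from [s] to [s.+1]. *)
pose m := (Num.trunc (N * tau)).+1.
pose rn I := run cand (pick_vertex E A D tau) m [ffun=> None] I.
exists (fun I => (rn I).1 :|: (TC (rn I).2).1 I), (fun I => (TC (rn I).2).2 I).
split.
  apply: (@fingerprint_comp V _ _ (fun I => (rn I).1) (fun I => (rn I).2)
    (fun x => (TC x).1) (fun x => (TC x).2)); first exact: run_fingerprint.
  by move=> x; have [] := HTC x.
move=> I indI.
pose P k sg := [/\ valid E A sg I,
  (forall S, S != set0 -> (hdeg (link E sg) (used A sg) S)%:R <= 2 * D * tau ^+ #|S|)
  & k%:R * threshold alpha D <= #|used A sg|%:R].
have P0 : P 0%N [ffun=> None].
  split.
  - by move=> j v _; rewrite ffunE.
  - move=> S _; rewrite (_ : used A _ = set0).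
      rewrite /hdeg (_ : [set _ in _ | _] = set0) ?cards0.
        by rewrite !mulr_ge0 ?exprn_ge0 // ltW.
      by apply/setP => j; rewrite !inE.
    by apply/setP => j; rewrite !inE ffunE eqxx andbF.
  - by rewrite mul0r.
have PS k y v : P k y -> v \in I -> v \in cand y -> P k.+1 (pick_vertex E A D tau y v).
  move=> [P1 P2 P3] vI vc; split.
  - exact: valid_pick.
  - exact: spread_pick.
  - by rewrite -addn1 natrD mulrDl mul1r (le_trans _ (card_used_pick vc)) // lerD2r.
have [k [P1 P2 P3] Hk] := run_ind m P0 PS.
rewrite -/(rn I) in P1 P2 P3 Hk.
have [_ /(_ I indI P1)] := HTC (rn I).2; case.
- move=> S S0; rewrite -mulrA -exprS prednK ?card_gt0 //; exact: P2.
- case: Hk => [km|]; last by right.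
  left; apply: le_trans P3; rewrite {}km.
  have -> : a' * N * D * tau = N * tau * (a' * D) by ring.
  have ma : a' <= alpha / 4.
    rewrite /a' /used_density ler_pM2l // lef_pV2 ?posrE ?exprn_gt0 //.
    rewrite !exprS; have : 1 <= 2 ^+ s :> R by rewrite exprn_ege1 // ler1n.
    lra.
  apply: ler_pM => //.
  - by rewrite ltW // mulr_gt0.
  - exact/ltW/truncnS_gt.
  - by rewrite /threshold ler_wpM2r // ltW.
move=> T2 -> -> ->; split=> //.
apply: (@le_trans _ _ (m%:R + 2 * s%:R * (N * tau))).
  apply: le_trans (_ : (#|(rn I).1| + #|(TC (rn I).2).1 I|)%:R <= _).
    by rewrite ler_nat leq_card_setU.
  by rewrite natrD lerD // ler_nat run_card.
have : m%:R <= 1 + N * tau.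
  by rewrite /m -addn1 natrD addrC lerD2l truncn_le (le_trans _ NT).
rewrite -[s.+1]addn1 natrD. lra.
Qed.

(* The lemma above is iterated, each application removing delta * N vertices,
   until few hyperedges are left. *)
Lemma containers (R : realType) (s : nat) (alpha : R) : (0 < s)%N -> 0 < alpha ->
  exists2 K : R, 0 < K &
  forall (V J : finType) (E : J -> {set V}) (A : {set J}) (X : {set V}) (N D tau : R),
  0 < D -> 0 < tau -> tau <= 1 -> #|X|%:R <= N -> 1 <= N * tau ->
  (forall j, j \in A -> E j \subset X) -> (forall j, j \in A -> #|E j| = s) -> spread E A D tau ->
  exists T C : {set V} -> {set V}, fingerprint T C /\
    (forall I : {set V}, I \subset X -> independent E A I -> #|T I|%:R <= K * (N * tau) /\ I \subset C I) /\
    (forall I : {set V}, #|[set j in A | E j \subset C I]|%:R <= alpha * N * D).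
Proof.
move=> s0 alpha0; have [delta delta0 H] := container_lemma s alpha0.
pose L := (Num.trunc delta^-1).+1.
pose K0 : R := 2 * s%:R.
have K00 : 0 < K0 by rewrite mulr_gt0 // ltr0n.
exists (L%:R * K0); first by rewrite mulr_gt0 ?ltr0n.
move=> V J E A X N D tau D0 tau0 tau1 XN NT AX Es EA.
have N0 : 0 < N by rewrite -(pmulr_lgt0 _ tau0); apply: lt_le_trans NT.
have NT0 : 0 <= N * tau by rewrite ltW // mulr_gt0.
have aND : 0 <= alpha * N * D by rewrite ltW // !mulr_gt0.
(* Here [C0] is the current container and [k] the number of rounds left; each round removes
   [delta * N] of its elements. *)
suff main (k : nat) (C0 : {set V}) : #|C0|%:R <= k%:R * (delta * N) ->
   exists T C : {set V} -> {set V}, fingerprint T C /\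
    (forall I : {set V}, I \subset C0 -> independent E A I ->
       #|T I|%:R <= k%:R * K0 * (N * tau) /\ I \subset C I) /\
    (forall I : {set V}, #|[set j in A | E j \subset C I]|%:R <= alpha * N * D).
  have [|T [C [fp [H1 H2]]]] := main L X.
    rewrite (le_trans XN) // mulrA -[leLHS]mul1r ler_pM2r //.
    by rewrite -ler_pdivrMr // div1r; exact/ltW/truncnS_gt.
  by exists T, C.
elim: k C0 => [|k IHk] C0.
  rewrite mul0r lern0 cards_eq0 => /eqP ->.
  exists (fun=> set0), (fun=> set0); split; first exact: fingerprint_cst.
  split=> [I I0 _|_]; first by rewrite cards0 !mul0r I0.
  rewrite (_ : [set _ in _ | _] = set0) ?cards0 //.
  apply/setP => j; rewrite !inE; apply/negP => /andP[jA].
  by rewrite subset0 => /eqP E0; have := Es j jA; rewrite E0 cards0 => s00; rewrite -s00 in s0.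
move=> C0k.
pose A0 := [set j in A | E j \subset C0].
have [leA|ltA] := leP (#|A0|%:R) (alpha * N * D).
  exists (fun=> set0), (fun=> C0); split; first exact: fingerprint_cst.
  by split=> [I IC _|_ //]; rewrite cards0 !mulr_ge0 // ltW // !mulr_gt0.
have A0E j : j \in A0 -> #|E j| = s by rewrite inE => /andP[/Es].
have sp0 : spread E A0 D tau.
  move=> S S0; apply: le_trans (EA S S0); rewrite ler_nat subset_leq_card //.
  by apply/subsetP => j; rewrite !inE => /andP[/andP[-> _] ->].
have A0X j : j \in A0 -> E j \subset X by rewrite inE => /andP[/AX].
have [T1 [C1 [fp1 H1]]] := H V J E A0 X N D tau D0 tau0 tau1 XN NT A0X A0E sp0 (ltW ltA).
(* The later rounds are fixed for every possible container [Y] beforehand, so that they depend on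
   [I] only through [C1 I]. *)
have /fin_all_exists[TC HTC] (Y : {set V}) :
  exists TC : ({set V} -> {set V}) * ({set V} -> {set V}),
  [/\ fingerprint TC.1 TC.2,
    #|C0 :&: Y|%:R <= k%:R * (delta * N) -> (forall I : {set V}, I \subset C0 :&: Y -> independent E A I ->
       #|TC.1 I|%:R <= k%:R * K0 * (N * tau) /\ I \subset TC.2 I) &
    (forall I : {set V}, #|[set j in A | E j \subset TC.2 I]|%:R <= alpha * N * D)].
  have [/IHk[T [C [fp [T1' T2']]]]|gtY] := leP #|C0 :&: Y|%:R (k%:R * (delta * N)).
    by exists (T, C).
  exists (fun=> set0, fun=> set0); split=> //=; first exact: fingerprint_cst.
  rewrite (_ : [set _ in _ | _] = set0) ?cards0 //.
  apply/setP => j; rewrite !inE; apply/negP => /andP[jA].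
  by rewrite subset0 => /eqP E0; have := Es j jA; rewrite E0 cards0 => s00; rewrite -s00 in s0.
exists (fun I => T1 I :|: (TC (C1 I)).1 I), (fun I => (TC (C1 I)).2 I); split.
  apply: (@fingerprint_comp V _ _ T1 C1 (fun x => (TC x).1) (fun x => (TC x).2)) => //.
  by move=> x; have [] := HTC x.
split=> I; last by have [] := HTC (C1 I).
move=> IC indI.
have ind0 : independent E A0 I.
  apply/forall_inP => j; rewrite inE => /andP[jA _]; exact: (forall_inP indI).
have [T1K IC1 C1d C1sub] := H1 I ind0.
have [_ HX _] := HTC (C1 I).
have subC : ~: C1 I \subset C0.
  apply: subset_trans C1sub _; apply/bigcupsP => j; by rewrite inE => /andP[].
have cC : #|C0 :&: C1 I|%:R <= k%:R * (delta * N).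
  have : (#|C0 :&: C1 I| + #|~: C1 I| = #|C0|)%N.
    by rewrite -(cardsID (C1 I) C0) setDE (setIidPr subC).
  move/(congr1 (fun n => n%:R : R)); rewrite natrD => e.
  move: C0k; rewrite -e -addn1 natrD mulrDl mul1r => C0k.
  by rewrite -(lerD2r (delta * N)); apply: le_trans C0k; rewrite lerD2l.
have [|T2K IC2] := HX cC I _ indI; first by rewrite subsetI IC.
split=> //.
apply: le_trans (_ : (#|T1 I| + #|(TC (C1 I)).1 I|)%:R <= _).
  by rewrite ler_nat leq_card_setU.
rewrite natrD -[k.+1]addn1 natrD !mulrDl mul1r addrC lerD //.
Qed.

(** * Containers for F-free graphs *)

Lemma card_ffun_into (S T : finType) (U : {set S}) (Z : {set T}) :
  #|[set f : {ffun S -> T} | [forall x in U, f x \in Z]]| =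
    (#|Z| ^ #|U| * #|T| ^ (#|S| - #|U|))%N.
Proof.
pose F x := [pred y | (x \in U) ==> (y \in Z)].
rewrite (eq_card (B := family F)); last first.
  move=> f; rewrite inE; apply/forall_inP/familyP => H x.
    by rewrite inE; apply/implyP/H.
  by have := H x; rewrite inE => /implyP.
rewrite card_family foldrE big_map big_enum /= (bigID (mem U)) /=.
have F1 x : x \in U -> #|F x| = #|Z| by move=> xU; apply: eq_card => y; rewrite inE xU.
have F2 x : x \notin U -> #|F x| = #|T|.
  by move=> xU; apply: eq_card => y; rewrite inE (negbTE xU).
rewrite (eq_bigr _ F1) (eq_bigr _ F2) !prod_nat_const; congr (_ * _ ^ _)%N.
have -> : #|[pred x | x \notin U]| = #|~: U| by apply: eq_card => x; rewrite !inE.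
by rewrite cardsCs setCK.
Qed.

Definition img (S T : finType) (E : {set {set S}}) (f : {ffun S -> T}) : {set {set T}} :=
  [set f @: (e : {set S}) | e in E].

Lemma copiesE (S T : finType) (E : {set {set S}}) (C : {set {set T}}) (f : {ffun S -> T}) :
  (f \in copies E C) = injectiveb f && (img E f \subset C).
Proof.
rewrite inE; congr (_ && _); apply/forall_inP/subsetP => H.
  by move=> _ /imsetP[e eE ->]; exact: H.
by move=> e eE; apply: H; exact: imset_f.
Qed.

Lemma card_img (S T : finType) (E : {set {set S}}) (f : {ffun S -> T}) :
  injective f -> #|img E f| = #|E|.
Proof. by move=> finj; rewrite card_imset //; exact: imset_inj. Qed.

(** Sort the embeddings by the set [E'] of edges mapped into [B]: the vertices covered by [E'] land
    in [cover B], and the others are free. *)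
Lemma card_copies_meeting (S T : finType) (E : {set {set S}}) (B : {set {set T}}) (v : nat) :
  (#|cover B| <= v)%N ->
  forall P : pred {set {set S}},
  (#|[set f : {ffun S -> T} | injectiveb f && P [set e in E | f @: e \in B]]| <=
     \sum_(E' : {set {set S}} | (E' \subset E) && P E')
        v ^ #|cover E'| * #|T| ^ (#|S| - #|cover E'|))%N.
Proof.
move=> Bv P.
apply: (@leq_trans (\sum_(E' : {set {set S}} | (E' \subset E) && P E')
    #|[set f : {ffun S -> T} | [forall x in cover E', f x \in cover B]]|)); last first.
  apply: leq_sum => E' _; rewrite card_ffun_into leq_mul2r; apply/orP; right.
  by case: #|cover E'| => // k; rewrite leq_exp2r.
apply: leq_trans (leq_card_bigcup _ _); apply: subset_leq_card.
apply/subsetP => f; rewrite inE => /andP[_ Pf]; apply/bigcupP.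
exists [set e in E | f @: e \in B].
  by rewrite Pf andbT; apply/subsetP => e; rewrite inE => /andP[].
rewrite inE; apply/forall_inP => x /bigcupP[e]; rewrite inE => /andP[eE eB] xe.
by apply/bigcupP; exists (f @: e); rewrite ?imset_f.
Qed.

Lemma powRDpos (R : realType) (x r s : R) : 0 < x -> x `^ (r + s) = x `^ r * x `^ s.
Proof. by move=> x0; rewrite powRD ?(gt_eqF x0) ?implybT. Qed.

Lemma powRBpos (R : realType) (x r s : R) : 0 < x -> x `^ (r - s) = x `^ r / x `^ s.
Proof. by move=> x0; rewrite powRB ?(gt_eqF x0) ?implybT. Qed.

Section PowerBounds.
Variables (R : realType) (S : finType) (E : {set {set S}}) (theta : R).
Hypothesis Etheta : forall E' : {set {set S}}, E' \subset E -> E' != set0 ->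
  theta * (#|E'|%:R - 1) <= #|cover E'|%:R - 2.

(** [Etheta] rearranged as an inequality between exponents of [n]; it is the 2-density condition for
    [theta] at most 1 over the 2-density. *)
Lemma expn_cover_le (n : nat) (E' : {set {set S}}) : (0 < n)%N ->
  E' \subset E -> E' != set0 ->
  n%:R ^+ (#|S| - #|cover E'|) <=
    n%:R ^+ #|S| / n%:R ^+ 2 * (n%:R `^ (- theta)) ^+ #|E'|.-1 :> R.
Proof.
move=> n0 E'E E'0; have nR : 0 < n%:R :> R by rewrite ltr0n.
have n1 : 1 <= n%:R :> R by rewrite ler1n.
have cS : (#|cover E'| <= #|S|)%N by rewrite max_card.
have -> : n%:R ^+ #|S| / n%:R ^+ 2 * (n%:R `^ (- theta)) ^+ #|E'|.-1 =
    n%:R `^ (#|S|%:R - 2 - theta * (#|E'|%:R - 1)) :> R.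
  rewrite powRBpos // powRBpos // powRrM [in RHS]powR_mulrn ?ltW //.
  have -> : #|E'|%:R - 1 = #|E'|.-1%:R :> R by rewrite -subn1 natrB // card_gt0.
  by rewrite !powR_mulrn ?ltW ?powR_gt0 // powRN exprVn.
rewrite -powR_mulrn ?(ltW nR) // natrB //; apply: ler_powR => //.
have := Etheta E'E E'0; lra.
Qed.

End PowerBounds.

(** An image containing [B] has a set [E'] of exactly [#|B|] edges mapped onto [B]. The power of 2
    is a crude bound for the number of such [E'], and [#|S| ^ #|S|] bounds the placements of the
    vertices covered by [E']. *)
Lemma copies_spread (R : realType) (S : finType) (E : {set {set S}}) (theta : R) :
  (forall E' : {set {set S}}, E' \subset E -> E' != set0 ->
    theta * (#|E'|%:R - 1) <= #|cover E'|%:R - 2) ->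
  forall n, (0 < n)%N ->
  spread (img E) [set f : {ffun S -> 'I_n} | injectiveb f]
    (2 ^+ #|{set {set S}}| * #|S|%:R ^+ #|S| * (n%:R ^+ #|S| / n%:R ^+ 2)) (n%:R `^ (- theta) : R).
Proof.
move=> Etheta n n0 B B0; have nR : 0 < n%:R :> R by rewrite ltr0n.
have [Bv|vB] := leqP #|cover B| #|S|; last first.
  rewrite /hdeg (_ : [set _ in _ | _] = set0); last first.
    apply/setP => f; rewrite !inE; apply/negP => /andP[_ sub].
    move: vB; rewrite ltnNge => /negP; apply.
    apply: leq_trans (leq_imset_card f S).
    apply: subset_leq_card; apply/subsetP => y /bigcupP[b bB yb].
    have := subsetP sub b bB => /imsetP[e _ eb]; move: yb; rewrite eb => /imsetP[x _ ->].
    exact: imset_f.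
  by rewrite cards0 !mulr_ge0 ?exprn_ge0 ?invr_ge0 ?powR_ge0 ?exprn_ge0.
have := card_copies_meeting (T := 'I_n) E Bv (fun E' => #|E'| == #|B|).
rewrite card_ord -(ler_nat R) natr_sum => H.
apply: le_trans (le_trans H _).
  rewrite ler_nat; apply: subset_leq_card; apply/subsetP => f; rewrite !inE.
  move=> /andP[finj sub]; rewrite finj /=; apply/eqP.
  rewrite -(card_imset _ (imset_inj (injectiveP f finj))); congr #|pred_of_set _|.
  apply/setP => b; apply/imsetP/idP => [[e]|bB].
    by rewrite inE => /andP[_ eB] ->.
  have /imsetP[e eE eb] := subsetP sub b bB.
  by exists e; rewrite // inE eE -eb.
have cB (E' : {set {set S}}) : (#|E'| == #|B|) -> E' != set0.
  by move=> /eqP c; rewrite -card_gt0 c card_gt0.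
apply: (@le_trans _ _ (\sum_(E' : {set {set S}}) #|S|%:R ^+ #|S| *
   (n%:R ^+ #|S| / n%:R ^+ 2) * n%:R `^ (- theta) ^+ #|B|.-1)); last first.
  rewrite sumr_const -[_ *+ _]mulr_natl !mulrA ler_wpM2r ?exprn_ge0 ?powR_ge0 //.
  rewrite !ler_wpM2r ?invr_ge0 ?exprn_ge0 // -natrX ler_nat.
  by rewrite ltnW // ltn_expl.
rewrite [leRHS](bigID (fun E' : {set {set S}} => (E' \subset E) && (#|E'| == #|B|))) /=.
rewrite ler_wpDr //.
  by apply: sumr_ge0 => E' _; rewrite !mulr_ge0 ?exprn_ge0 ?invr_ge0 ?powR_ge0 ?exprn_ge0.
apply: ler_sum => E' /andP[E'E E'B]; rewrite natrM !natrX -mulrA.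
have := expn_cover_le Etheta n0 E'E (cB _ E'B); rewrite (eqP E'B) => HE.
apply: ler_pM; rewrite ?exprn_ge0 //.
rewrite -natrX -natrX ler_nat.
have cS : (#|cover E'| <= #|S|)%N by rewrite max_card.
by case: #|S| cS => [|k] cS; [move: cS; rewrite leqn0 => /eqP -> | rewrite leq_pexp2l].
Qed.

(** The containers are taken in the hypergraph whose vertices are the pairs in ['I_n] and whose
    hyperedges are the copies of [E]. With [N = n ^ 2], the product [N * D] is [c * n ^ #|S|], which
    explains the density [eps / c]. *)
Lemma copies_containers (R : realType) (S : finType) (E : {set {set S}}) (theta : R)
    (eps : R) :
  E != set0 -> (forall e, e \in E -> #|e| = 2%N) -> 0 <= theta <= 1 ->
  (forall E' : {set {set S}}, E' \subset E -> E' != set0 ->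
    theta * (#|E'|%:R - 1) <= #|cover E'|%:R - 2) ->
  0 < eps ->
  exists2 K : R, 0 < K & forall n, (0 < n)%N ->
  exists T C : {set {set 'I_n}} -> {set {set 'I_n}}, fingerprint T C /\
    (forall I : {set {set 'I_n}}, (forall e, e \in I -> #|e| = 2%N) ->
       copies E I = set0 ->
       #|T I|%:R <= K * (n%:R ^+ 2 * n%:R `^ (- theta)) /\ I \subset C I) /\
    (forall I, #|copies E (C I)|%:R <= eps * n%:R ^+ #|S|).
Proof.
move=> E0 E2 /andP[th0 th1] Etheta eps0.
pose c : R := 2 ^+ #|{set {set S}}| * #|S|%:R ^+ #|S|.
have S0 : (0 < #|S|)%N.
  have /set0Pn[e /E2 e2] := E0.
  by have := max_card e; rewrite e2; case: #|S|.
have c0 : 0 < c by rewrite mulr_gt0 // exprn_gt0 // ltr0n.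
have E_gt0 : (0 < #|E|)%N by rewrite card_gt0.
have [K K0 HK] := containers (R := R) E_gt0 (divr_gt0 eps0 c0).
exists K => // n n0.
have nR : 0 < n%:R :> R by rewrite ltr0n.
have n1 : 1 <= n%:R :> R by rewrite ler1n.
pose A := [set f : {ffun S -> 'I_n} | injectiveb f].
pose X := [set e : {set 'I_n} | #|e| == 2%N].
have [||||||||T [C [fp [H1 H2]]]] := HK _ _ (img E) A X (n%:R ^+ 2)
    (c * (n%:R ^+ #|S| / n%:R ^+ 2)) (n%:R `^ (- theta)).
- by rewrite mulr_gt0 // divr_gt0 // exprn_gt0.
- exact: powR_gt0.
- rewrite -[leRHS](powRr0 n%:R); apply: ler_powR => //; lra.
- rewrite card_draws card_ord -natrX ler_nat bin2.
  by rewrite -divn2 (leq_trans (leq_div _ _)) // leq_mul2l leq_pred orbT.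
- rewrite -(powR_mulrn 2 (ltW nR)) -powRDpos //.
  rewrite -[leLHS](powRr0 n%:R); apply: ler_powR => //; lra.
- move=> f; rewrite inE => /injectiveP finj; apply/subsetP => _ /imsetP[e eE ->].
  by rewrite inE card_imset // E2.
- by move=> f; rewrite inE => /injectiveP finj; rewrite card_img.
- exact: copies_spread.
exists T, C; split=> //; split=> I.
  move=> I2 cI; apply: H1; first by apply/subsetP => e /I2/eqP; rewrite inE.
  apply/forall_inP => f fA; apply/negP => sub.
  have : f \in copies E I by rewrite copiesE sub andbT; rewrite inE in fA.
  by rewrite cI inE.
apply: le_trans (_ : #|[set f in A | img E f \subset C I]|%:R <= _).
  rewrite ler_nat; apply: subset_leq_card; apply/subsetP => f.
  by rewrite copiesE [in X in _ -> X]inE [_ \in A]inE.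
apply: le_trans (H2 I) _; rewrite le_eqVlt; apply/orP; left; apply/eqP.
by field; rewrite (gt_eqF c0) (gt_eqF nR).
Qed.

(** * Product measures and the Efron-Stein inequality *)

Section ProductMeasure.
Variables (R : realType) (Om : finType) (w : Om -> R).
Implicit Types (W A : {set Om}) (f g : {set Om} -> R) (i j : Om).

Definition prob W : R := \prod_i (if i \in W then w i else 1 - w i).
Definition expect f : R := \sum_W prob W * f W.
Definition weight A : R := \prod_(i in A) w i.

Hypothesis w01 : forall i, 0 <= w i <= 1.

Lemma prob_ge0 W : 0 <= prob W.
Proof.
apply: prodr_ge0 => i _; have /andP[w0 w1] := w01 i.
by case: ifP; rewrite ?subr_ge0.
Qed.

Lemma weight_ge0 A : 0 <= weight A.
Proof. by apply: prodr_ge0 => i _; have /andP[] := w01 i. Qed.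

(** Expand the product of the sums [F i + G i] over all [W]: the zeros of [F] and [G] kill every
    term whose [W] does not meet [U] in exactly [A]. *)
Lemma expect_cylinder (U A : {set Om}) : A \subset U ->
  expect (fun W => (W :&: U == A)%:R) = \prod_(i in U) (if i \in A then w i else 1 - w i).
Proof.
move=> /subsetP AU.
pose F i := if (i \in U) && (i \notin A) then 0 else w i.
pose G i := if i \in A then 0 else 1 - w i.
have := bigA_distr 1 +%R F G (mul := *%R).
rewrite [LHS](_ : _ = \prod_(i in U) (if i \in A then w i else 1 - w i)) => [->|].
  apply: eq_bigr => W _; rewrite /prob; have [/eqP WU|] := boolP (W :&: U == A).
    rewrite mulr1; apply: eq_bigr => i _; rewrite /F /G -WU inE.
    by case: (i \in W); rewrite ?andbN //= andbN.
  move=> WU; rewrite mulr0.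
  have /existsP[i Hi] : [exists i, (i \in W :&: U) != (i \in A)].
    apply: contraNT WU; rewrite negb_exists => /forallP H.
    by apply/eqP/setP => i; have := H i; rewrite negbK => /eqP.
  rewrite (bigD1 i) //= /F /G; move: Hi; rewrite inE; have := AU i.
  case: (i \in W); case: (i \in A); case: (i \in U) => //= H; rewrite ?mul0r //.
  by have := H isT.
rewrite [RHS]big_mkcond; apply: eq_bigr => i _; rewrite /F /G; have := AU i.
case: (i \in A) => /= [->//|_]; first by rewrite addr0.
by case: (i \in U); rewrite ?add0r // addrC subrK.
Qed.

Lemma expect_subset A : expect (fun W => (A \subset W)%:R) = weight A.
Proof.
transitivity (expect (fun W => (W :&: A == A)%:R)).
  apply: eq_bigr => W _; congr (_ * (nat_of_bool _)%:R).
  by apply/idP/eqP => [/setIidPr|/setIidPr].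
by rewrite expect_cylinder //; apply: eq_bigr => i ->.
Qed.

Lemma expect_cst c : expect (fun=> c) = c.
Proof.
rewrite /expect -mulr_suml; have := expect_subset set0.
rewrite /expect /weight big_set0; under eq_bigr do rewrite sub0set mulr1.
by move=> ->; rewrite mul1r.
Qed.

Lemma expectD f g : expect (fun W => f W + g W) = expect f + expect g.
Proof. by rewrite -big_split; apply: eq_bigr => W _; rewrite mulrDr. Qed.

Lemma expectZ c f : expect (fun W => c * f W) = c * expect f.
Proof. by rewrite mulr_sumr; apply: eq_bigr => W _; rewrite mulrCA. Qed.

Lemma expectB f g : expect (fun W => f W - g W) = expect f - expect g.
Proof. by rewrite -sumrB; apply: eq_bigr => W _; rewrite mulrBr. Qed.

Lemma expect_sum (I : Type) (r : seq I) (P : pred I) (F : I -> {set Om} -> R) :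
  expect (fun W => \sum_(i <- r | P i) F i W) = \sum_(i <- r | P i) expect (F i).
Proof.
rewrite /expect exchange_big /=; apply: eq_bigr => W _; exact: mulr_sumr.
Qed.

Lemma le_expect f g : (forall W, f W <= g W) -> expect f <= expect g.
Proof. by move=> fg; apply: ler_sum => W _; rewrite ler_wpM2l // prob_ge0. Qed.

Lemma eq_expect f g : f =1 g -> expect f = expect g.
Proof. by move=> fg; apply: eq_bigr => W _; rewrite fg. Qed.

(** The conditional expectation that integrates out coordinate [i]; [diff] is the discrete
    derivative in this coordinate. *)
Definition average i f W := w i * f (i |: W) + (1 - w i) * f (W :\ i).
Definition diff i f W := f (i |: W) - f (W :\ i).

Lemma expect_average i f : expect (average i f) = expect f.
Proof.
pose prob' W := \prod_(j | j != i) (if j \in W then w j else 1 - w j).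
have split (g : {set Om} -> R) :
    expect g = \sum_(W : {set Om} | i \notin W) prob' W * (w i * g (i |: W) + (1 - w i) * g W).
  rewrite /expect (bigID (fun W => i \in W)) /=.
  rewrite (reindex_onto (fun W => i |: W) (fun W => W :\ i)) /=; last first.
    by move=> W iW; rewrite setD1K.
  rewrite (eq_bigl (fun W => i \notin W)) => [|W]; last first.
    rewrite setU11 /=; apply/eqP/idP => [<-|iW]; first by rewrite !inE eqxx.
    by rewrite setU1K.
  rewrite -big_split; apply: eq_bigr => W iW.
  rewrite /prob (bigD1 i) //= setU11 [in X in _ + X](bigD1 i) //= (negbTE iW).
  rewrite (eq_bigr (fun j => if j \in W then w j else 1 - w j)) => [|j ji]; last first.
    by rewrite !inE (negbTE ji).
  rewrite -/(prob' W); ring.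
rewrite !split; apply: eq_bigr => W iW; congr (_ * _).
have W1 : (i |: W) :\ i = W by rewrite setU1K.
have W2 : W :\ i = W.
  by apply/setP => j; rewrite !inE; case: eqP => // ->; rewrite (negbTE iW).
by rewrite /average setUA setUid W1 W2; ring.
Qed.

(** The variance of a two-valued random variable. *)
Lemma average_sqr i f W :
  average i (fun W => f W ^+ 2) W - average i f W ^+ 2 = w i * (1 - w i) * diff i f W ^+ 2.
Proof. rewrite /average /diff; ring. Qed.

Definition averages (s : seq Om) f := foldr average f s.

Lemma expect_averages s f : expect (averages s f) = expect f.
Proof. by elim: s => //= i s <-; rewrite expect_average. Qed.

Lemma diff_average i j f W : i != j -> diff i (average j f) W = average j (diff i f) W.
Proof.
move=> ij; rewrite /average /diff.
have -> : j |: (i |: W) = i |: (j |: W) by rewrite setUCA.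
have -> : (i |: W) :\ j = i |: (W :\ j).
  by apply/setP => x; rewrite !inE; have [->|] := eqVneq x i; rewrite ?ij.
have -> : j |: (W :\ i) = (j |: W) :\ i.
  by apply/setP => x; rewrite !inE; have [->|] := eqVneq x j; rewrite 1?eq_sym ?ij.
have -> : W :\ i :\ j = W :\ j :\ i by rewrite !setDDl setUC.
ring.
Qed.

Lemma eq_average i f g : f =1 g -> average i f =1 average i g.
Proof. by move=> fg W; rewrite /average !fg. Qed.

Lemma diff_averages i s f : i \notin s -> diff i (averages s f) =1 averages s (diff i f).
Proof.
elim: s => //= j s IHs; rewrite inE negb_or => /andP[ij /IHs IH] W.
by rewrite diff_average //; exact: eq_average.
Qed.

Lemma expect_averages_sqr s f : expect (fun W => averages s f W ^+ 2) <= expect (fun W => f W ^+ 2).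
Proof.
elim: s => //= i s; apply: le_trans.
rewrite -[leRHS](expect_average i); apply: le_expect => W.
rewrite -subr_ge0 average_sqr mulr_ge0 ?sqr_ge0 //.
by have /andP[w0 w1] := w01 i; rewrite mulr_ge0 // subr_ge0.
Qed.

Lemma averages_indep s f W W' : (forall i, i \notin s -> (i \in W) = (i \in W')) ->
  averages s f W = averages s f W'.
Proof.
elim: s W W' => /= [|i s IHs] W W' H.
  by congr f; apply/setP => i; exact: H.
by rewrite /average; congr (_ * _ + _ * _); apply: IHs => j js; rewrite !inE;
  have [//|ji] := eqVneq j i; rewrite H // inE negb_or ji.
Qed.

(** Integrating out the coordinates one by one turns [f] into the constant [expect f]. The step for
    [i] lowers the second moment by the variance in coordinate [i] of an average of [f]; as [diff i]
    commutes with averaging over other coordinates and averaging contracts second moments, this loss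
    is at most the term of [i]. *)
Lemma efron_stein f :
  expect (fun W => (f W - expect f) ^+ 2) <=
    \sum_i w i * (1 - w i) * expect (fun W => diff i f W ^+ 2).
Proof.
have H s : uniq s -> expect (fun W => f W ^+ 2) - expect (fun W => averages s f W ^+ 2) <=
    \sum_(i <- s) w i * (1 - w i) * expect (fun W => diff i f W ^+ 2).
  elim: s => [|i s IHs] /=; first by rewrite subrr big_nil.
  move=> /andP[iS us]; rewrite big_cons.
  have : expect (fun W => averages s f W ^+ 2) - expect (fun W => average i (averages s f) W ^+ 2) <=
      w i * (1 - w i) * expect (fun W => diff i f W ^+ 2).
    rewrite -[X in X - _](expect_average i) -expectB (eq_expect (average_sqr i _)) expectZ ler_wpM2l //.
      by have /andP[w0 w1] := w01 i; rewrite mulr_ge0 // subr_ge0.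
    rewrite (eq_expect (g := fun W => averages s (diff i f) W ^+ 2)); first exact: expect_averages_sqr.
    by move=> W; rewrite diff_averages.
  by have := IHs us; lra.
have cst : averages (index_enum Om) f =1 fun=> expect f.
  move=> W; rewrite -(expect_averages (index_enum Om)) -[LHS]expect_cst; apply: eq_expect => W'.
  by apply: averages_indep => i; rewrite mem_index_enum.
have := H (index_enum Om) (index_enum_uniq Om).
rewrite (eq_expect (f := fun W => averages _ f W ^+ 2) (g := fun=> expect f ^+ 2)); last first.
  by move=> W; rewrite cst.
rewrite expect_cst.
apply: le_trans; rewrite le_eqVlt; apply/orP; left; apply/eqP.
rewrite (eq_expect (g := fun W => f W ^+ 2 + (- (2 * expect f) * f W + expect f ^+ 2))).
  rewrite !expectD expectZ expect_cst; ring.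
by move=> W; ring.
Qed.

End ProductMeasure.

(** * Disjoint supports inside a random set *)

Section Packings.
Variables (R : realType) (Om : finType) (w : Om -> R).
Hypothesis w01 : forall i, 0 <= w i <= 1.
Variables (Phi : finType) (supp : Phi -> {set Om}).
Implicit Types (W : {set Om}) (S B : {set Phi}).

Definition packing S :=
  [forall f in S, forall g in S, (f != g) ==> [disjoint supp f & supp g]].

Definition union_supp S := \bigcup_(f in S) supp f.

Lemma packingP S :
  reflect (forall f g, f \in S -> g \in S -> f != g -> [disjoint supp f & supp g]) (packing S).
Proof.
apply: (iffP forall_inP) => H f; last first.
  by move=> fS; apply/forall_inP => g gS; apply/implyP; exact: H.
by move=> g fS gS; have /forall_inP/(_ g gS)/implyP := H f fS.
Qed.

Lemma packingS S S' : S \subset S' -> packing S' -> packing S.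
Proof.
move=> /subsetP SS /packingP H; apply/packingP => f g /SS fS /SS gS; exact: H.
Qed.

Lemma weight_union_supp S : packing S -> weight w (union_supp S) = \prod_(f in S) weight w (supp f).
Proof.
move=> /packingP H; rewrite /weight /union_supp [\bigcup_(f in S) _]big_mkcond /=.
rewrite (partition_disjoint_bigcup _ (F := fun f => if f \in S then supp f else set0)).
  rewrite [RHS]big_mkcond; apply: eq_bigr => f _; case: ifP => //.
  by rewrite big_set0.
move=> f g fg; rewrite -setI_eq0; case: ifP => fS; last by rewrite set0I.
by case: ifP => gS; rewrite ?setI0 // setI_eq0 H.
Qed.

Variable B : {set Phi}.

Definition packings_in W S :=
  [&& S \subset B, packing S & union_supp S \subset W].

(** The matching number of the hypergraph of the supports of [B] contained in [W]. *)
Definition nu W : nat := \max_(S : {set Phi} | packings_in W S) #|S|.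

Lemma nu_ge W S : packings_in W S -> (#|S| <= nu W)%N.
Proof. exact: (@leq_bigmax_cond _ (packings_in W) (fun S => #|S|)). Qed.

Lemma nu_attained W : exists2 S, packings_in W S & #|S| = nu W.
Proof.
have H : (0 < #|packings_in W|)%N.
  apply/card_gt0P; exists set0; rewrite unfold_in /packings_in sub0set /=.
  rewrite /union_supp big_set0 sub0set andbT.
  by apply/packingP => f g; rewrite inE.
by have [S HS e] := eq_bigmax_cond (fun S : {set Phi} => #|S|) H; exists S.
Qed.

Lemma nuS W W' : W \subset W' -> (nu W <= nu W')%N.
Proof.
move=> WW; have [S /and3P[SB Sp SW] <-] := nu_attained W.
by apply: nu_ge; rewrite /packings_in SB Sp (subset_trans SW WW).
Qed.

Lemma nuU1 i W : (nu (i |: W) <= (nu (W :\ i)).+1)%N.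
Proof.
have [S /and3P[SB Sp SW] <-] := nu_attained (i |: W).
pose S' := [set f in S | i \notin supp f].
have S'S : S' \subset S by apply/subsetP => f; rewrite inE => /andP[].
have HS' : packings_in (W :\ i) S'.
  rewrite /packings_in (subset_trans S'S SB) (packingS S'S Sp) /=.
  apply/bigcupsP => f; rewrite inE => /andP[fS iF]; apply/subsetP => x xf.
  have xi : x != i by apply: contraNneq iF => <-.
  have : x \in i |: W by apply: (subsetP SW); apply/bigcupP; exists f.
  by rewrite !inE xi (negbTE xi).
apply: leq_trans (_ : (#|S'| + 1)%N <= _)%N; last by rewrite addn1 ltnS nu_ge.
rewrite -(cardsID S' S) (setIidPr S'S) leq_add2l.
apply/card_le1_eqP => f g; rewrite !inE => /andP[fi fS] /andP[gi gS].
rewrite fS /= negbK in fi; rewrite gS /= negbK in gi.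
apply/eqP; apply: contraLR (erefl true) => fg /=.
have /disjoint_setI0 := packingP _ Sp g f gS fS fg.
by move=> /setP/(_ i); rewrite !inE fi gi.
Qed.

Lemma diff_nu i W : 0 <= diff i (fun W => (nu W)%:R : R) W <= 1.
Proof.
rewrite /diff subr_ge0 ler_nat lerBlDr nat1r ler_nat nuU1 andbT.
by apply: nuS; apply/subsetP => x; rewrite !inE => /andP[_ ->]; rewrite orbT.
Qed.

Variable a : nat.
Hypothesis supp_a : forall f, f \in B -> (#|supp f| <= a)%N.

(** Deleting [i] can lower [nu] only if [i] lies in the union of a fixed optimal packing, which has
    at most [a * nu W] elements, and then by at most 1. *)
Lemma sum_diff_nu W :
  \sum_(i in W) ((nu W)%:R - (nu (W :\ i))%:R) <= a%:R * (nu W)%:R :> R.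
Proof.
have [S /and3P[SB Sp SW] cS] := nu_attained W.
apply: (@le_trans _ _ (\sum_(i in union_supp S) 1)).
  rewrite big_mkcond [leRHS]big_mkcond /=; apply: ler_sum => i _.
  have le1 : (nu W)%:R - (nu (W :\ i))%:R <= 1 :> R.
    rewrite lerBlDr nat1r ler_nat; apply: leq_trans (nuU1 i W).
    by apply: nuS; exact: subsetUr.
  case: ifP => iW; last by case: ifP.
  case: ifP => // iS; rewrite subr_le0 ler_nat -cS; apply: nu_ge.
  rewrite /packings_in SB Sp /=; apply/subsetP => x xS; rewrite !inE (subsetP SW _ xS) andbT.
  by apply: contraFneq iS => <-.
rewrite sumr_const -natrM ler_nat -cS mulnC -sum_nat_const.
apply: leq_trans (leq_card_bigcup _ _) _; apply: leq_sum => f fS.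
exact/supp_a/(subsetP SB).
Qed.

(** As the differences lie in [0, 1], their squares in the Efron-Stein bound are at most the
    differences themselves. Weighted by [w i], these average the loss caused by deleting [i] from
    [W], which [sum_diff_nu] sums up. *)
Lemma var_nu : expect w (fun W => ((nu W)%:R - expect w (fun W => (nu W)%:R)) ^+ 2) <=
  a%:R * expect w (fun W => (nu W)%:R).
Proof.
apply: le_trans (efron_stein w01 _) _.
rewrite -expectZ; apply: le_trans (le_expect w01 sum_diff_nu).
rewrite (eq_expect _ (g := fun W => \sum_i (i \in W)%:R * ((nu W)%:R - (nu (W :\ i))%:R))).
  rewrite expect_sum; apply: ler_sum => i _.
  rewrite -[leRHS](expect_average _ i) -mulrA -!expectZ; apply: le_expect => // W.
  rewrite /average !inE eqxx /= mul1r mul0r mulr0 addr0.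
  have /andP[w0 w1] := w01 i.
  rewrite ler_wpM2l //.
  have -> : (i |: W) :\ i = W :\ i.
    by apply/setP => x; rewrite !inE; case: eqP.
  have /andP[d0 d1] := diff_nu i W.
  rewrite -/(diff i (fun W => (nu W)%:R) W) expr2 mulrA ler_piMl // mulr_ile1 //; lra.
by move=> W; rewrite big_mkcond; apply: eq_bigr => i _; case: (i \in W); rewrite ?mul1r ?mul0r.
Qed.

Definition meets f := [set g in B | (g != f) && ~~ [disjoint supp f & supp g]].

(** The supports in [W] that meet no other support in [W] form a packing; every other support in [W]
    is paid for by one of the intersecting pairs. *)
Lemma nu_isolated W :
  \sum_(f in B) (supp f \subset W)%:R -
  \sum_(f in B) \sum_(g in meets f) (supp f :|: supp g \subset W)%:R <= (nu W)%:R :> R.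
Proof.
pose S := [set f in B | (supp f \subset W) &&
   [forall g in meets f, ~~ (supp f :|: supp g \subset W)]].
have HS : packings_in W S.
  apply/and3P; split.
  - by apply/subsetP => f; rewrite inE => /andP[].
  - apply/packingP => f g; rewrite !inE => /and3P[fB fW /forall_inP fg] /and3P[gB gW _] ne.
    apply/negP => /negP nd; have := fg g; rewrite !inE gB eq_sym ne nd subUset fW gW.
    by move=> /(_ isT).
  - by apply/bigcupsP => f; rewrite inE => /and3P[].
rewrite lerBlDr; set Y := \sum_(f in B) \sum_(g in meets f) _.
apply: (@le_trans _ _ (#|S|%:R + Y)); last by rewrite lerD2r ler_nat nu_ge.
rewrite /Y {Y}.
rewrite -sum1_card natr_sum big_mkcond /= [X in X + _]big_mkcond [X in _ + X]big_mkcond -big_split /=.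
apply: ler_sum => f _; rewrite inE; case: (f \in B) => /=; last by rewrite addr0.
have [fW|fW] /= := boolP (supp f \subset W); last first.
  by rewrite add0r sumr_ge0.
have [_|] /= := boolP [forall g in meets f, ~~ (supp f :|: supp g \subset W)]; first by rewrite lerDl sumr_ge0.
rewrite negb_forall => /existsP[g]; rewrite negb_imply negbK => /andP[gf sub].
by rewrite add0r (bigD1 g) //= sub lerDl sumr_ge0.
Qed.

Definition mean : R := \sum_(f in B) weight w (supp f).

(* Efron-Stein bounds the variance of nu by a * E nu, so that Chebyshev's
   inequality applies although the individual supports overlap heavily. *)
Lemma nu_lower_tail (e : R) : 0 < e -> 0 < mean ->
  \sum_(f in B) \sum_(g in meets f) weight w (supp f :|: supp g) <= e / 2 * mean ->
  expect w (fun W => ((nu W)%:R < (1 - e) * mean)%R%:R) <= 4 * a%:R / (e ^+ 2 * mean).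
Proof.
move=> e0 m0 He.
set En := expect w (fun W => (nu W)%:R).
(* Half of [e] is spent on intersecting pairs; the other half is the deviation in Chebyshev's
   inequality. *)
have En_ge : (1 - e / 2) * mean <= En.
  apply: le_trans (le_expect w01 nu_isolated); rewrite expectB !expect_sum.
  rewrite (eq_bigr (fun f => weight w (supp f))) => [|f _]; last exact: expect_subset.
  rewrite -/mean mulrBl mul1r lerD2l lerN2; apply: le_trans He.
  rewrite le_eqVlt; apply/orP; left; apply/eqP; apply: eq_bigr => f _.
  by rewrite expect_sum; apply: eq_bigr => g _; exact: expect_subset.
have En_le : En <= mean.
  have -> : mean = expect w (fun W => \sum_(f in B) (supp f \subset W)%:R).
    by rewrite expect_sum; apply: eq_bigr => f _; rewrite expect_subset.
  apply: le_expect => // W.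
  have [S /and3P[SB Sp SW] <-] := nu_attained W.
  rewrite -natr_sum ler_nat -sum1_card big_mkcond [leqRHS]big_mkcond /=.
  apply: leq_sum => f _; case: ifP => // fS; rewrite (subsetP SB _ fS).
  by rewrite (subset_trans _ SW) // (bigcup_sup f).
have t0 : 0 < (e / 2 * mean) ^+ 2 by rewrite exprn_gt0 // mulr_gt0 // divr_gt0.
rewrite -(ler_pM2l t0) -expectZ.
apply: (@le_trans _ _ (a%:R * mean)); last first.
  rewrite le_eqVlt; apply/orP; left; apply/eqP; field.
  by rewrite (gt_eqF e0) (gt_eqF m0).
apply: le_trans (_ : a%:R * En <= _); last by rewrite ler_wpM2l.
apply: le_trans var_nu; apply: le_expect => // W; rewrite -/En.
case: ltP => H; last by rewrite mulr0 sqr_ge0.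
rewrite mulr1 -[leRHS]sqrrN ler_sqr ?nnegrE; last 2 first.
- by rewrite ltW // mulr_gt0 // divr_gt0.
- by rewrite opprB subr_ge0; nra.
by rewrite opprB; nra.
Qed.

End Packings.

(** The bound of an elementary symmetric polynomial by a power of the sum: each [S] arises from [k!]
    injective sequences in the expansion. *)
Lemma sum_prod_draws (R : realFieldType) (I : finType) (A : {set I}) (x : I -> R) (k : nat) :
  (forall i, 0 <= x i) ->
  \sum_(S : {set I} | (S \subset A) && (#|S| == k)) \prod_(i in S) x i <=
    (\sum_(i in A) x i) ^+ k / k`!%:R.
Proof.
move=> x0; rewrite ler_pdivlMr ?ltr0n ?fact_gt0 //.
have -> : (\sum_(i in A) x i) ^+ k =
    \sum_(f : {ffun 'I_k -> I} | f \in ffun_on (mem A)) \prod_i x (f i).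
  rewrite -(bigA_distr_big (mem A) (fun (_ : 'I_k) i => x i)).
  by rewrite prodr_const card_ord.
rewrite [leRHS](bigID (fun f : {ffun 'I_k -> I} => injectiveb f)) /=.
rewrite ler_wpDr ?sumr_ge0 // => [f _|]; first exact: prodr_ge0.
rewrite (partition_big (fun f : {ffun 'I_k -> I} => f @: setT)
   (fun S : {set I} => (S \subset A) && (#|S| == k))) /=; last first.
  move=> f /andP[/ffun_onP fA /injectiveP finj].
  rewrite card_imset // cardsT card_ord eqxx andbT.
  by apply/subsetP => _ /imsetP[i _ ->]; exact: fA.
rewrite mulr_suml; apply: ler_sum => S /andP[SA /eqP Sk].
have imS (f : {ffun 'I_k -> I}) :
    [&& f \in ffun_on (mem A), injectiveb f & f @: setT == S] ->
    \prod_i x (f i) = \prod_(i in S) x i.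
  move=> /and3P[_ /injectiveP finj /eqP <-].
  rewrite big_imset /=; last by move=> i j _ _; exact: finj.
  by apply: eq_bigl => i; rewrite inE.
rewrite [leRHS](eq_bigr (fun=> \prod_(i in S) x i)) => [|f]; last first.
  by rewrite -andbA; exact: imS.
rewrite sumr_const -[leRHS]mulr_natr ler_wpM2l ?prodr_ge0 //.
have <- : #|[set f : {ffun 'I_k -> I} in ffun_on (mem S) | injectiveb f]| = k`!.
  by rewrite card_inj_ffuns_on card_ord Sk ffactnn.
rewrite ler_nat.
apply: subset_leq_card; apply/subsetP => f; rewrite !inE => /andP[/ffun_onP fS finj].
have fSE : f @: setT \subset S by apply/subsetP => _ /imsetP[i _ ->]; exact: fS.
rewrite unfold_in finj andbT; apply/andP; split.
  by apply/ffun_onP => i; exact: (subsetP SA _ (fS i)).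
rewrite eqEcard fSE card_imset; last exact/injectiveP.
by rewrite cardsT card_ord Sk leqnn.
Qed.

Lemma expn_sub_le_ffact (n m : nat) : ((n - m) ^ m <= n ^_ m)%N.
Proof.
rewrite ffact_prod -{2}[m]card_ord -prod_nat_const.
by apply: leq_prod => i _; have := ltn_ord i; lia.
Qed.

(** * First moment bound for marked packings *)

Section MarkedPackings.
Variables (R : realType) (Om : finType) (w : Om -> R).
Hypothesis w01 : forall i, 0 <= w i <= 1.
Variables (Phi M : finType) (supp : Phi -> {set Om}) (B : {set Phi}).
Variable bad : {set Phi * M} -> {set Phi}.
Variables (lam : R) (t0 k k' : nat).
Hypothesis bad_lam : forall F, \sum_(f in bad F) weight w (supp f) <= lam.
Hypothesis t0k : (t0 + k' <= k)%N.

Definition base (F : {set Phi * M}) : {set Phi} := [set x.1 | x in F].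

(* The marked members F of the packing S determine a family bad F to which all
   members of S belong. *)
Definition marked_event W :=
  [exists F : {set Phi * M}, [exists S : {set Phi},
    [&& (#|F| <= t0)%N, dinjectiveb fst (mem F), base F \subset S,
        packings_in supp B W S, S \subset bad F & (k <= #|S|)%N]]].

Definition small_family (F : {set Phi * M}) :=
  [&& (#|F| <= t0)%N, dinjectiveb fst (mem F) & F \subset setX B setT].

Definition extends F (S' : {set Phi}) :=
  packing supp (base F :|: S') && [disjoint base F & S'].

Definition draws F := fun S' : {set Phi} => (S' \subset bad F) && (#|S'| == k').

(** A packing witnessing the event has at least [k - t0] members outside [base F], hence at least
    ['C(k - t0, k')] subfamilies of size [k'] that are counted on the right. *)
Lemma marked_event_le W :
  (marked_event W)%:R * 'C(k - t0, k')%:R <=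
  \sum_(F | small_family F) \sum_(S' | draws F S')
     (extends F S')%:R * (union_supp supp (base F :|: S') \subset W)%:R :> R.
Proof.
have ge0 : 0 <= \sum_(F | small_family F) \sum_(S' | draws F S')
     (extends F S')%:R * (union_supp supp (base F :|: S') \subset W)%:R :> R.
  by rewrite sumr_ge0 // => F _; rewrite sumr_ge0 // => S' _; rewrite mulr_ge0.
case: (boolP (marked_event W)) => [|_]; last by rewrite mul0r.
move=> /existsP[F /existsP[S /and5P[Ft Finj FS SW /andP[Sbad kS]]]]; rewrite mul1r.
have /and3P[SB Sp SsubW] := SW.
have cF : #|base F| = #|F| by rewrite card_in_imset //; exact/dinjectiveP.
have smF : small_family F.
  rewrite /small_family Ft Finj /=; apply/subsetP => -[f m] fF; rewrite inE in_setT andbT /=.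
  by apply: (subsetP SB); apply: (subsetP FS); apply/imsetP; exists (f, m).
rewrite (bigD1 F) //= ler_wpDr //.
  by rewrite sumr_ge0 // => G _; rewrite sumr_ge0 // => S' _; rewrite mulr_ge0.
apply: (@le_trans _ _ (\sum_(S' : {set Phi} | (S' \subset S :\: base F) && (#|S'| == k')) 1)).
  rewrite sumr_const ler_nat.
  rewrite (_ : #|_| = 'C(#|S :\: base F|, k')); last first.
    by rewrite -cards_draws; apply: eq_card => S'; rewrite inE.
  apply: leq_bin2l; rewrite cardsD (setIidPr FS) cF; lia.
rewrite [leLHS]big_mkcond [leRHS]big_mkcond /=; apply: ler_sum => S' _.
case: ifP => [/andP[S'S S'k]|_]; last by case: ifP => // _; rewrite mulr_ge0.
have S'S2 : S' \subset S by apply: subset_trans S'S (subsetDl _ _).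
have US : base F :|: S' \subset S by rewrite subUset FS.
rewrite /draws (subset_trans S'S2 Sbad) S'k /=.
have -> : extends F S'.
  rewrite /extends (packingS US Sp) /= -setI_eq0; apply/eqP/setP => x; rewrite !inE.
  by apply/negP => /andP[xF /(subsetP S'S)]; rewrite inE xF.
rewrite (_ : _ \subset W) ?mulr1 //.
by apply: subset_trans SsubW; apply/bigcupsP => f fU; apply: (bigcup_sup f) => //; exact: (subsetP US).
Qed.

Lemma weight_extends F S' : small_family F -> extends F S' ->
  weight w (union_supp supp (base F :|: S')) =
    (\prod_(x in F) weight w (supp x.1)) * \prod_(f in S') weight w (supp f).
Proof.
move=> /and3P[_ /dinjectiveP Finj _] /andP[pk disj].
rewrite weight_union_supp // (eq_bigl [predU base F & S']) => [|x]; last by rewrite !inE.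
rewrite bigU //=; congr (_ * _).
by rewrite big_imset.
Qed.

(** Disjoint supports make the weights multiply. The families [F] of size [t] contribute the term of
    index [t], the draws from [bad F] contribute [lam ^+ k' / k'!], and the factorial cancels
    against the binomial coefficient. *)
Lemma marked_first_moment : 0 <= lam ->
  expect w (fun W => (marked_event W)%:R) * (k - t0 - k')%:R ^+ k' <=
    (\sum_(t < t0.+1) (#|M|%:R * mean w supp B) ^+ t / t`!%:R) * lam ^+ k'.
Proof.
move=> lam0.
have Ez0 : 0 <= expect w (fun W => (marked_event W)%:R).
  by rewrite /expect sumr_ge0 // => W _; rewrite mulr_ge0 // prob_ge0.
apply: (@le_trans _ _ (expect w (fun W => (marked_event W)%:R) * 'C(k - t0, k')%:R * k'`!%:R)).
  by rewrite -mulrA -natrM bin_ffact ler_wpM2l // -natrX ler_nat expn_sub_le_ffact.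
rewrite -ler_pdivlMr ?ltr0n ?fact_gt0 // -mulrA.
rewrite mulrC -expectZ.
rewrite (eq_expect _ (g := fun W => (marked_event W)%:R * 'C(k - t0, k')%:R)); last first.
  by move=> W; rewrite mulrC.
apply: le_trans (le_expect w01 marked_event_le) _; rewrite expect_sum.
apply: (@le_trans _ _ (\sum_(F | small_family F)
    (\prod_(x in F) weight w (supp x.1)) * (lam ^+ k' / k'`!%:R))).
  apply: ler_sum => F smF; rewrite expect_sum.
  apply: (@le_trans _ _ (\sum_(S' | draws F S') (\prod_(x in F) weight w (supp x.1)) *
       \prod_(f in S') weight w (supp f))).
    apply: ler_sum => S' _; rewrite expectZ expect_subset.
    have [ext|_] := boolP (extends F S'); first by rewrite mul1r weight_extends.
    by rewrite mul0r mulr_ge0 ?prodr_ge0 // => *; exact: weight_ge0.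
  rewrite -mulr_sumr ler_wpM2l //; first by rewrite prodr_ge0 // => *; exact: weight_ge0.
  apply: le_trans (sum_prod_draws _ _ _) _; first by move=> f; exact: weight_ge0.
  rewrite ler_wpM2r ?invr_ge0 ?ler0n // lerXn2r ?nnegrE //.
  by rewrite sumr_ge0 // => *; exact: weight_ge0.
rewrite -mulr_suml ler_wpM2r //.
  by rewrite divr_ge0 ?exprn_ge0.
pose m (F : {set Phi * M}) : 'I_t0.+1 := inord #|F|.
rewrite (partition_big m xpredT) //=; apply: ler_sum => t _.
have -> : #|M|%:R * mean w supp B = \sum_(x in setX B [set: M]) weight w (supp x.1).
  rewrite /mean mulr_sumr (eq_bigr (fun f => \sum_(m : M) weight w (supp f))) => [|f _]; last first.
    by rewrite sumr_const mulr_natl.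
  rewrite pair_big_dep /=; apply: eq_bigl => x; by rewrite !inE andbT.
apply: le_trans (sum_prod_draws _ _ _); last by move=> x; exact: weight_ge0.
rewrite [leLHS]big_mkcond [leRHS]big_mkcond /=; apply: ler_sum => F _.
case: ifP => [/andP[/and3P[Ft _ ->] /eqP <-]|_].
  by rewrite /m inordK ?eqxx ?ltnS.
by case: ifP => // _; rewrite prodr_ge0 // => *; exact: weight_ge0.
Qed.

End MarkedPackings.

Lemma sum_exp_coeff_le (R : realType) (x : R) (n : nat) : 0 <= x ->
  \sum_(t < n) x ^+ t / t`!%:R <= expR x.
Proof.
move=> x0; rewrite -(big_mkord xpredT (fun t => x ^+ t / t`!%:R)).
apply: (nondecreasing_cvgn_le _ (is_cvg_series_exp_coeff x)).
apply/nondecreasing_seqP => k; rewrite /series /= big_nat_recr //= lerDl.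
exact: exp_coeff_ge0.
Qed.

(** With [k'] about [zeta * mu / 8], at least [(1 - zeta / 2) * mu] members remain, so each draw
    gains a factor [(1 - zeta) / (1 - zeta / 2) <= expR (- (zeta / 2))]. In total this is twice the
    exponent that the choice of the marked family costs. *)
Lemma first_moment_numerics (R : realType) (m : nat) (zeta : R) :
  (0 < m)%N -> 0 < zeta <= 1 ->
  exists2 beta : R, 0 < beta & exists2 c : R, 0 < c &
  forall (mu : R) (t0 k : nat), 0 < mu -> t0%:R <= beta * mu ->
  (1 - zeta / 8) * mu <= k%:R ->
  exists2 k' : nat, (t0 + k' <= k)%N & forall x : R,
    x * (k - t0 - k')%:R ^+ k' <=
      (\sum_(t < t0.+1) (m%:R * mu) ^+ t / t`!%:R) * ((1 - zeta) * mu) ^+ k' ->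
    x <= c / mu.
Proof.
move=> m0 /andP[z0 z1].
have mR : 1 <= m%:R :> R by rewrite ler1n.
pose L : R := 128 * m%:R / zeta ^+ 2.
have z20 : 0 < zeta ^+ 2 by rewrite exprn_gt0.
have z21 : zeta ^+ 2 <= zeta by rewrite expr2 ler_piMl // ltW.
have L0 : 0 < L by rewrite divr_gt0 // mulr_gt0 // ltr0n.
(* With this choice (m / beta) ^ (beta * mu) = exp (L * beta * mu). *)
pose beta : R := m%:R * expR (- L).
have b0 : 0 < beta by rewrite mulr_gt0 ?expR_gt0 // ltr0n.
(* Squaring [1 + L / 2 <= expR (L / 2)] gives a bound quadratic in [L], enough to beat the factor
   [L + 1] and the size of [m]. *)
have bL : beta * (L + 1) <= zeta ^+ 2 / 32.
  have e1 : expR L = expR (L / 2) ^+ 2 by rewrite -expRM_natl; congr expR; field.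
  have e2 : 1 + L / 2 <= expR (L / 2) by exact: expR_ge1Dx.
  have e3 : (1 + L / 2) ^+ 2 <= expR L by rewrite e1 lerXn2r ?nnegrE ?expR_ge0 //; lra.
  rewrite /beta expRN mulrAC ler_pdivrMr ?expR_gt0 //.
  have -> : m%:R * (L + 1) = zeta ^+ 2 / 32 * (L / 4 * (L + 1)).
    by rewrite /L; field; rewrite gt_eqF.
  rewrite ler_wpM2l //; first by rewrite divr_ge0 // ltW.
  apply: le_trans e3; nra.
exists beta => //; pose c : R := expR 1 * 32 / zeta ^+ 2.
have c0 : 0 < c by rewrite divr_gt0 // mulr_gt0 // expR_gt0.
exists c => // mu t0 k mu0 t0b kmu.
pose k' := Num.trunc (zeta * mu / 8).
have zm0 : 0 <= zeta * mu / 8 by rewrite divr_ge0 // mulr_ge0 // ltW.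
have k'1 : k'%:R <= zeta * mu / 8 by rewrite truncn_le.
have k'2 : zeta * mu / 8 < k'%:R + 1 by rewrite natr1; exact: truncnS_gt.
have bz : beta <= zeta / 8.
  have : beta <= beta * (L + 1) by rewrite ler_peMr ?ltW //; lra.
  lra.
have t0z : t0%:R <= zeta / 8 * mu by apply: le_trans t0b _; rewrite ler_pM2r.
have tk : (t0 + k' <= k)%N by rewrite -(ler_nat R) natrD; nra.
exists k' => // x.
have denE : (k - t0 - k')%:R = k%:R - t0%:R - k'%:R :> R.
  by rewrite -subnDA natrB // natrD opprD addrA.
have den : (1 - zeta / 2) * mu <= (k - t0 - k')%:R by rewrite denE; nra.
have den0 : 0 < (1 - zeta / 2) * mu by rewrite mulr_gt0 //; lra.
have dpos : 0 < (k - t0 - k')%:R :> R by apply: lt_le_trans den.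
rewrite -ler_pdivlMr ?exprn_gt0 // -mulrA -expr_div_n => /le_trans; apply.
(* Writing [m * mu] as [expR L * (beta * mu)] and using [t <= t0] extracts the factor
   [expR (L * t0)]; what is left is a partial sum of the series of [expR (beta * mu)]. *)
have A1 : \sum_(t < t0.+1) (m%:R * mu) ^+ t / t`!%:R <= expR (zeta ^+ 2 / 32 * mu).
  apply: (@le_trans _ _ (expR (L * t0%:R) * expR (beta * mu))).
    apply: (@le_trans _ _ (expR (L * t0%:R) * \sum_(t < t0.+1) (beta * mu) ^+ t / t`!%:R)); last first.
      by rewrite ler_wpM2l ?expR_ge0 // sum_exp_coeff_le // mulr_ge0 // ltW.
    rewrite mulr_sumr; apply: ler_sum => t _.
    rewrite mulrA ler_wpM2r ?invr_ge0 ?ler0n //.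
    have -> : m%:R * mu = expR L * (beta * mu).
      rewrite /beta expRN; field; by rewrite gt_eqF ?expR_gt0.
    rewrite exprMn ler_wpM2r //.
      by rewrite exprn_ge0 // ltW // mulr_gt0.
    by rewrite -expRM_natr ler_expR ler_wpM2l ?(ltW L0) // ler_nat -ltnS.
  rewrite -expRD ler_expR.
  apply: (@le_trans _ _ (beta * (L + 1) * mu)); last by rewrite ler_pM2r.
  nra.
have A2 : ((1 - zeta) * mu / (k - t0 - k')%:R) ^+ k' <= expR (1 - zeta ^+ 2 / 16 * mu).
  apply: (@le_trans _ _ (expR (- (zeta / 2)) ^+ k')).
    rewrite lerXn2r ?nnegrE ?expR_ge0 //.
      by rewrite divr_ge0 // ?(ltW dpos) // mulr_ge0 ?(ltW mu0) // subr_ge0.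
    apply: le_trans (expR_ge1Dx _); rewrite ler_pdivrMr //.
    apply: le_trans (_ : (1 - zeta / 2) * ((1 - zeta / 2) * mu) <= _).
      rewrite mulrA ler_pM2r //; nra.
    rewrite ler_wpM2l //; lra.
  rewrite -expRM_natl ler_expR; nra.
apply: (@le_trans _ _ (expR (zeta ^+ 2 / 32 * mu) * expR (1 - zeta ^+ 2 / 16 * mu))).
  apply: ler_pM => //.
    by apply: sumr_ge0 => t _; rewrite mulr_ge0 ?invr_ge0 ?ler0n ?exprn_ge0 ?mulr_ge0 ?(ltW mu0).
  by rewrite exprn_ge0 // divr_ge0 ?(ltW dpos) // mulr_ge0 ?(ltW mu0) // subr_ge0.
rewrite -expRD.
have -> : zeta ^+ 2 / 32 * mu + (1 - zeta ^+ 2 / 16 * mu) = 1 - zeta ^+ 2 / 32 * mu by field.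
rewrite expRB ler_pdivrMr ?expR_gt0 //.
have -> : c / mu = expR 1 / (zeta ^+ 2 / 32 * mu).
  by rewrite /c; field; rewrite ?gt_eqF.
have y0 : 0 < zeta ^+ 2 / 32 * mu by rewrite mulr_gt0 // divr_gt0.
rewrite mulrAC ler_pdivlMr // ler_pM2l ?expR_gt0 //.
by apply: le_trans (expR_ge1Dx _); rewrite lerDr.
Qed.

(** * Application to the binomial random graph *)

Section Graphs.
Variable T : finType.
Implicit Types (G : sgraph T) (U : {set T}) (X : {set {set T}}).

Lemma edges2 G e : e \in edges G -> #|e| = 2%N.
Proof. by have /forall_inP H := valP G; move=> /H /andP[/eqP]. Qed.

Lemma edges_verts G e : e \in edges G -> e \subset verts G.
Proof. by have /forall_inP H := valP G; move=> /H /andP[]. Qed.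

Lemma span_subproof U X :
  [forall e in [set e in X | (#|e| == 2%N) && (e \subset U)],
    (#|e| == 2%N) && (e \subset U)].
Proof. by apply/forall_inP => e; rewrite inE => /andP[]. Qed.

Definition span U X : sgraph T :=
  @SGraph T (U, [set e in X | (#|e| == 2%N) && (e \subset U)]) (span_subproof U X).

(** Turns the densities, which are maxima over subgraphs, into inequalities for sets of edges, the
    form used by the counting lemmas. *)
Lemma subgraph_span G X : X \subset edges G ->
  [/\ subgraph (span (cover X) X) G, verts (span (cover X) X) = cover X &
      edges (span (cover X) X) = X].
Proof.
move=> XG.
have eX : edges (span (cover X) X) = X.
  apply/setP => e; rewrite inE; apply/andP/idP => [[]//|eX]; split=> //.
  by rewrite (edges2 (subsetP XG e eX)) eqxx; exact: (bigcup_sup e).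
split=> //; rewrite /subgraph eX XG andbT.
by apply/bigcupsP => e eX'; exact/edges_verts/(subsetP XG).
Qed.

Lemma cover_ge2 G X : X \subset edges G -> X != set0 -> (1 < #|cover X|)%N.
Proof.
move=> XG /set0Pn[e eX]; rewrite -(edges2 (subsetP XG e eX)).
by apply: subset_leq_card; exact: (bigcup_sup e).
Qed.

Lemma cover_eq2 G X : X \subset edges G -> X != set0 ->
  (#|cover X| == 2%N) = (#|X| == 1%N).
Proof.
move=> XG X0; apply/eqP/eqP => [c2|/eqP/cards1P[e eX]].
  have /set0Pn[e eX] := X0.
  have all_e f : f \in X -> f = cover X.
    move=> fX; apply/eqP; rewrite eqEcard c2 (edges2 (subsetP XG f fX)) leqnn andbT.
    exact: (bigcup_sup f).
  apply/eqP/cards1P; exists e; apply/setP => f; rewrite inE.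
  by apply/idP/eqP => [fX|->//]; rewrite (all_e f) // (all_e e).
by rewrite eX /cover big_set1; apply: (edges2 (subsetP XG e _)); rewrite eX inE.
Qed.

Variable R : realType.

(** Without division the inequality also covers a single edge, where both sides vanish although [d2]
    has the special value 1/2. *)
Lemma edges_le_m2 G X : X \subset edges G -> X != set0 ->
  #|X|%:R - 1 <= m2 R G * (#|cover X|%:R - 2).
Proof.
move=> XG X0; have [sub vX eX] := subgraph_span XG.
have := cover_ge2 XG X0; rewrite leq_eqVlt eq_sym (cover_eq2 XG X0).
have [/eqP X1|X1 /= c3] := boolP (#|X| == 1%N).
  have /eqP -> : #|cover X| == 2%N by rewrite (cover_eq2 XG X0) X1.
  by rewrite X1 !subrr mulr0.
have c0 : 0 < #|cover X|%:R - 2 :> R by rewrite subr_gt0 ltr_nat.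
rewrite -ler_pdivrMr //.
have -> : (#|X|%:R - 1) / (#|cover X|%:R - 2) = d2 R (span (cover X) X).
  by rewrite /d2 vX eX (negbTE X1) andbF.
by apply: le_bigmax_cond; rewrite sub /has_edge eX.
Qed.

Lemma edges_le_m2asym (T2 : finType) G (G2 : sgraph T2) X :
  X \subset edges G -> X != set0 -> 0 < m2 R G2 ->
  #|X|%:R <= m2asym R G G2 * (#|cover X|%:R - 2 + 1 / m2 R G2).
Proof.
move=> XG X0 m0; have [sub vX eX] := subgraph_span XG.
rewrite -ler_pdivrMr; last first.
  rewrite ltr_wpDl ?divr_gt0 // subr_ge0 ler_nat; exact: cover_ge2 XG X0.
pose f (H : sgraph T) : R := #|edges H|%:R / (#|verts H|%:R - 2 + 1 / m2 R G2).
have -> : #|X|%:R / (#|cover X|%:R - 2 + 1 / m2 R G2) = f (span (cover X) X).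
  by rewrite /f vX eX.
by apply: (le_bigmax_cond _ f); rewrite sub /has_edge eX.
Qed.

End Graphs.

(** * The joint space of random edges and randomly kept embeddings *)

Section EdgeEmbeddingSpace.
Variables (R : realType) (n : nat) (S : finType) (p q : R).
Hypotheses (p01 : 0 <= p <= 1) (q01 : 0 <= q <= 1).

(* A random subset of this space is an instance of G(n,p) together with a random
   sparsification, with density q, of the family of all embeddings. *)
Definition space := ({set 'I_n} + {ffun S -> 'I_n})%type.

Definition space_weight (x : space) : R :=
  match x with inl e => if #|e| == 2%N then p else 0 | inr _ => q end.

Lemma space_weight01 x : 0 <= space_weight x <= 1.
Proof. by case: x => [e|f] //=; case: ifP; rewrite // lexx ler01. Qed.

Definition graph_part (W : {set space}) : sgraph 'I_n := span setT [set e | inl e \in W].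

(** For a graph [G] on all vertices, the event [graph_part W = G] is a cylinder over the coordinates
    of the pairs, whose probability is the product in [gnp_prob]. *)
Lemma gnp_probE (A : pred (sgraph 'I_n)) :
  gnp_prob p A = expect space_weight (fun W => (A (graph_part W))%:R).
Proof.
pose U : {set space} := [set inl e | e : {set 'I_n} in [set e : {set 'I_n} | #|e| == 2%N]].
have inlI : injective (@inl {set 'I_n} {ffun S -> 'I_n}) by move=> x y [].
have H (G : sgraph 'I_n) : verts G == setT ->
    \prod_(e : {set 'I_n} | #|e| == 2%N) (if e \in edges G then p else 1 - p) =
    expect space_weight (fun W => (graph_part W == G)%:R).
  move=> vG; pose A' : {set space} := [set inl e | e in edges G].
  have AU : A' \subset U.
    by apply: imsetS; apply/subsetP => e /edges2/eqP; rewrite inE.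
  transitivity (\prod_(i in U) (if i \in A' then space_weight i else 1 - space_weight i)).
    rewrite big_imset /=; last by move=> x y _ _; exact: inlI.
    rewrite [RHS](eq_bigl (fun e : {set 'I_n} => #|e| == 2%N)) => [|e]; last by rewrite inE.
    by apply: eq_bigr => e e2; rewrite mem_imset // e2.
  rewrite -expect_cylinder //.
  apply: eq_expect => W; congr (nat_of_bool _)%:R; apply/eqP/eqP => [WU|GW].
    apply: val_inj; rewrite [RHS]surjective_pairing; congr pair; first exact/esym/eqP.
    apply/setP => e; rewrite !inE subsetT andbT.
    by move/setP/(_ (inl e)): WU; rewrite inE !mem_imset // inE.
  rewrite /A' -GW; apply/setP => -[e|f]; rewrite inE; last first.
    by apply/andP/imsetP => [[_ /imsetP[]]|[]].
  by rewrite !mem_imset // !inE subsetT andbT.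
rewrite /gnp_prob (eq_bigr _ (fun G HG => H G (proj1 (andP HG)))).
rewrite -expect_sum; apply: eq_expect => W.
rewrite -natr_sum; congr _%:R.
have [AW|nA] := boolP (A (graph_part W)).
  rewrite (bigD1 (graph_part W)) /= ?eqxx ?AW //.
  rewrite big1 // => G /andP[_]; by rewrite eq_sym => /negbTE ->.
rewrite big1 // => G /andP[_ AG]; case: eqP => // e.
by rewrite e AG in nA.
Qed.


Variables (E : {set {set S}}).
Hypothesis E2 : forall e, e \in E -> #|e| = 2%N.

Definition sset (X : {set {set 'I_n}}) (Y : {set {ffun S -> 'I_n}}) : {set space} :=
  [set inl e | e in X] :|: [set inr f | f in Y].

(** Besides the edges of the copy, the support contains [inr f]: it lies in [W] when the copy is
    present in the graph and is kept. *)
Definition embedding_supp (f : {ffun S -> 'I_n}) : {set space} := sset (img E f) [set f].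

Definition embeddings : {set {ffun S -> 'I_n}} :=
  [set f : {ffun S -> 'I_n} | injectiveb f].

Lemma mem_sset_inl X Y (e : {set 'I_n}) : (inl e \in sset X Y) = (e \in X).
Proof.
rewrite inE mem_imset; last by move=> ? ? [].
by case: (e \in X) => //=; apply/imsetP => -[].
Qed.

Lemma mem_sset_inr X Y (f : {ffun S -> 'I_n}) : (inr f \in sset X Y) = (f \in Y).
Proof.
rewrite inE orbC mem_imset; last by move=> ? ? [].
by case: (f \in Y) => //=; apply/imsetP => -[].
Qed.

Lemma ssetU X Y X' Y' : sset X Y :|: sset X' Y' = sset (X :|: X') (Y :|: Y').
Proof.
by apply/setP => -[e|f]; rewrite inE ?mem_sset_inl ?mem_sset_inr inE.
Qed.

Lemma weight_sset (X : {set {set 'I_n}}) Y : (forall e, e \in X -> #|e| = 2%N) ->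
  weight space_weight (sset X Y) = p ^+ #|X| * q ^+ #|Y|.
Proof.
move=> X2; rewrite /weight /sset.
rewrite (eq_bigl [predU [set inl e | e in X] & [set inr f | f in Y]]) => [|x]; last by rewrite !inE.
rewrite bigU /=; last first.
  rewrite -setI_eq0; apply/eqP/setP => x; rewrite !inE.
  by apply/negP => /andP[/imsetP[e _ ->] /imsetP[]].
rewrite !big_imset /=; try by move=> ? ? _ _ [].
rewrite prodr_const (eq_bigr (fun=> p)) ?prodr_const // => e eX.
by rewrite X2.
Qed.

Lemma card_supp f : f \in embeddings -> (#|embedding_supp f| <= #|E|.+1)%N.
Proof.
rewrite inE => /injectiveP finj.
apply: leq_trans (leq_card_setU _ _) _; rewrite -addn1 leq_add //.
  by apply: leq_trans (leq_imset_card _ _) _; rewrite card_img.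
by apply: leq_trans (leq_imset_card _ _) _; rewrite cards1.
Qed.

Lemma img2 f : f \in embeddings -> forall e, e \in img E f -> #|e| = 2%N.
Proof.
rewrite inE => /injectiveP finj _ /imsetP[e eE ->].
by rewrite card_imset // E2.
Qed.

Lemma weight_supp f : f \in embeddings -> weight space_weight (embedding_supp f) = p ^+ #|E| * q.
Proof.
move=> fB; rewrite weight_sset; last exact: img2.
by rewrite cards1 expr1 card_img //; apply/injectiveP; rewrite inE in fB.
Qed.

Lemma mean_embeddings : mean space_weight embedding_supp embeddings = #|embeddings|%:R * (p ^+ #|E| * q).
Proof.
rewrite /mean (eq_bigr (fun=> p ^+ #|E| * q)) => [|f]; last exact: weight_supp.
by rewrite sumr_const mulr_natl.
Qed.

(** For fixed [f], group the [g] by the set [E'] of edges that they map into the image of [f]. There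
    are at most [#|S| ^ #|S| * n ^ (#|S| - #|cover E'|)] of them, each adding a factor
    [q * p ^+ (#|E| - #|E'|)] to the weight of [f]. *)
Lemma sum_meets_le (d : R) :
  0 <= d -> (forall E' : {set {set S}}, E' \subset E -> E' != set0 ->
     q * n%:R ^+ (#|S| - #|cover E'|) * p ^+ (#|E| - #|E'|) <= d) ->
  \sum_(f in embeddings) \sum_(g in meets embedding_supp embeddings f) weight space_weight (embedding_supp f :|: embedding_supp g) <=
  #|{set {set S}}|%:R * #|S|%:R ^+ #|S| * d * mean space_weight embedding_supp embeddings.
Proof.
move=> d0 Hd; have [/andP[p0 _] /andP[q0 _]] := (p01, q01).
rewrite /mean mulr_sumr; apply: ler_sum => f fB.
have finj : injective f by apply/injectiveP; rewrite inE in fB.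
pose common (g : {ffun S -> 'I_n}) := [set e in E | g @: (e : {set S}) \in img E f].
(* Since [g] differs from [f], the supports can only meet in an edge, so [common g] is nonempty; the
   union contains both [inr f] and [inr g], whence the second factor [q]. *)
have weightE g : g \in meets embedding_supp embeddings f ->
    [/\ injectiveb g, common g \subset E, common g != set0 &
    weight space_weight (embedding_supp f :|: embedding_supp g) = p ^+ #|E| * q * (q * p ^+ (#|E| - #|common g|))].
  rewrite inE => /and3P[gB gf]; have ginj : injective g by apply/injectiveP; rewrite inE in gB.
  have cI : img E f :&: img E g = [set g @: (e : {set S}) | e in common g].
    apply/setP => x; rewrite inE; apply/andP/imsetP => [[xf /imsetP[e eE xe]]|[e]].
      by exists e; rewrite // inE eE -xe.
    by rewrite inE => /andP[eE ef] ->; rewrite ef imset_f.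
  have cc : #|img E f :&: img E g| = #|common g|.
    by rewrite cI card_imset //; exact: imset_inj.
  have csub : common g \subset E by apply/subsetP => e; rewrite inE => /andP[].
  rewrite -setI_eq0 => /set0Pn[[e|h]]; rewrite inE ?mem_sset_inl ?mem_sset_inr; last first.
    by rewrite !inE => /andP[/eqP -> /eqP e]; rewrite e eqxx in gf.
  move=> /andP[ef eg]; split=> //.
  - by apply/injectiveP.
  - by rewrite -card_gt0 -cc card_gt0; apply/set0Pn; exists e; rewrite inE ef.
  rewrite ssetU weight_sset; last by move=> x /setUP[/(img2 fB)|/(img2 gB)].
  rewrite cards2 eq_sym gf expr2 cardsU !card_img // cc.
  rewrite -addnBA ?subset_leq_card // exprD.
  by move: (p ^+ _) (p ^+ _) => a b; ring.
pose mid : R := (\sum_(E' : {set {set S}} | (E' \subset E) && (E' != set0))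
   \sum_(g : {ffun S -> 'I_n} | injectiveb g && (common g == E')) p ^+ #|E| * q * (q * p ^+ (#|E| - #|E'|))).
apply: (@le_trans _ _ mid); rewrite /mid.
  rewrite (partition_big common (fun E' => (E' \subset E) && (E' != set0))) /=; last first.
    by move=> g /weightE[_ -> ->].
  apply: ler_sum => E' _; rewrite big_mkcond [leRHS]big_mkcond /=; apply: ler_sum => g _.
  case: ifP => [/andP[gm /eqP <-]|_].
    by have [-> _ _ ->] := weightE g gm; rewrite eqxx.
  by case: ifP => // _; rewrite !mulr_ge0 ?exprn_ge0.
have cf : (#|cover (img E f)| <= #|S|)%N.
  apply: leq_trans (leq_imset_card f S); apply: subset_leq_card.
  apply/subsetP => y /bigcupP[_ /imsetP[e _ ->] /imsetP[x _ ->]]; exact: imset_f.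
rewrite (weight_supp fB) -mulrA.
have -> : #|{set {set S}}|%:R * #|S|%:R ^+ #|S| * (d * (p ^+ #|E| * q)) =
   \sum_(E' : {set {set S}}) #|S|%:R ^+ #|S| * (d * (p ^+ #|E| * q)).
  by rewrite sumr_const -mulrA mulr_natl.
rewrite big_mkcond; apply: ler_sum => E' _; case: ifP => [/andP[E'E E'0]|_]; last first.
  by rewrite !mulr_ge0 ?exprn_ge0.
rewrite sumr_const -[_ *+ _]mulr_natl.
apply: (@le_trans _ _ ((#|S| ^ #|S| * n ^ (#|S| - #|cover E'|))%:R *
   (p ^+ #|E| * q * (q * p ^+ (#|E| - #|E'|))))).
  rewrite ler_wpM2r ?mulr_ge0 ?exprn_ge0 // ler_nat.
  have := card_copies_meeting (T := 'I_n) E cf (pred1 E').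
  rewrite card_ord => H; apply: leq_trans (leq_trans H _).
    by apply: subset_leq_card; apply/subsetP => g; rewrite unfold_in inE.
  rewrite (big_pred1 E') => [|X]; last first.
    by rewrite /=; case: eqP => [->|]; rewrite ?E'E ?andbF.
  rewrite leq_mul2r; apply/orP; right.
  have cS : (#|cover E'| <= #|S|)%N by rewrite max_card.
  by case: #|S| cS => [|k] cS; [move: cS; rewrite leqn0 => /eqP -> | rewrite leq_pexp2l].
rewrite natrM !natrX -mulrA ler_wpM2l ?exprn_ge0 //.
have -> : n%:R ^+ (#|S| - #|cover E'|) * (p ^+ #|E| * q * (q * p ^+ (#|E| - #|E'|))) =
  q * n%:R ^+ (#|S| - #|cover E'|) * p ^+ (#|E| - #|E'|) * (p ^+ #|E| * q).
  by move: (p ^+ _) (p ^+ _) (n%:R ^+ _) => a b c; ring.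
by rewrite ler_wpM2r ?mulr_ge0 ?exprn_ge0 // Hd.
Qed.

End EdgeEmbeddingSpace.

(** * From a colouring without monochromatic copies to a marked packing *)

Section Failure.
Variables (R : realType) (r : nat) (V : 'I_r -> finType).
Variables (F : forall i : 'I_r, sgraph (V i)) (i0 : 'I_r) (n : nat).
Variables (T C : 'I_r -> {set {set 'I_n}} -> {set {set 'I_n}}).
Variables (b : 'I_r -> R) (t0 k : nat).
Hypothesis TC : forall i, fingerprint (T i) (C i).
Hypothesis TCb : forall i (I : {set {set 'I_n}}), i != i0 ->
  (forall e, e \in I -> #|e| = 2%N) -> copies (edges (F i)) I = set0 ->
  #|T i I|%:R <= b i /\ I \subset C i I.
Hypothesis bt0 : \sum_(i | i != i0) b i < t0.+1%:R.

(** A mark is meant as an edge of [F i0] together with the colour of its image. *)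
Definition mark := ({set V i0} * 'I_r)%type.

Definition marked_edges (A : {set {ffun V i0 -> 'I_n} * mark}) (i : 'I_r) : {set {set 'I_n}} :=
  [set x.1 @: x.2.1 | x : {ffun V i0 -> 'I_n} * mark in A & x.2.2 == i].

Definition bad (A : {set {ffun V i0 -> 'I_n} * mark}) : {set {ffun V i0 -> 'I_n}} :=
  [set f in embeddings n (V i0) | [exists i : 'I_r, (i != i0) &&
     [exists e in edges (F i0), f @: (e : {set V i0}) \in C i (marked_edges A i)]]].

(** Take a largest packing [S]. Each member has an edge [y f] of a colour other than [i0], for
    otherwise it would be a copy in colour [i0]. The chosen edges of colour [i] form the set [X i],
    whose container is encoded by the members carrying its fingerprint; as it contains [X i], every
    member of [S] is bad. *)
Lemma failure_marked (W : {set space n (V i0)}) :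
  ~~ arrows (graph_part W) F -> (k <= nu (embedding_supp (edges (F i0))) (embeddings n (V i0)) W)%N ->
  marked_event (embedding_supp (edges (F i0))) (embeddings n (V i0)) bad t0 k W.
Proof.
rewrite negb_forall => /existsP[c]; rewrite negb_exists => /forallP nomono kW.
set G := graph_part W in nomono.
have [S SW cS] := nu_attained (embedding_supp (edges (F i0))) (embeddings n (V i0)) W.
have /and3P[SB /packingP Sp Ssub] := SW.
have Sinj f : f \in S -> injective f.
  by move=> /(subsetP SB); rewrite inE => /injectiveP.
have SG f e : f \in S -> e \in edges (F i0) -> f @: e \in edges G.
  move=> fS eF; rewrite !inE subsetT andbT card_imset ?(edges2 eF) ?eqxx ?andbT; last exact: Sinj.
  apply: (subsetP Ssub); apply/bigcupP; exists f => //.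
  by rewrite mem_sset_inl imset_f.
have nocopies i (I : {set {set 'I_n}}) : (forall e, e \in I -> e \in edges G /\ c e = i) ->
    copies (edges (F i)) I = set0.
  move=> IG; apply/setP => f; rewrite [RHS]inE; apply/negP; rewrite copiesE => /andP[finj fI].
  have := nomono i; rewrite negb_exists => /forallP/(_ f)/negP; apply.
  apply/and3P; split; apply/forall_inP => x xF.
  - by rewrite inE.
  - by apply/forall_inP => y _; rewrite (inj_eq (injectiveP _ finj)); apply/implyP.
  - have /IG[-> ->] : f @: x \in I by apply: (subsetP fI); exact: imset_f.
    by rewrite eqxx.
pose ok (f : {ffun V i0 -> 'I_n}) (m : mark) := [&& m.1 \in edges (F i0), m.2 == c (f @: m.1) & m.2 != i0].
pose mk (f : {ffun V i0 -> 'I_n}) : mark := odflt (set0, i0) [pick m | ok f m].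
have mkP f : f \in S -> ok f (mk f).
  move=> fS; rewrite /mk; case: pickP => [m //|no].
  have : f \in copies (edges (F i0)) [set e in edges G | c e == i0].
    rewrite inE; apply/andP; split; first exact/injectiveP/Sinj.
    apply/forall_inP => e eF; rewrite inE SG //=.
    by have := no (e, c (f @: e)); rewrite /ok eF eqxx /= => /negbFE.
  rewrite nocopies ?inE // => e; rewrite inE => /andP[? /eqP]; by split.
pose y (f : {ffun V i0 -> 'I_n}) := f @: (mk f).1.
(* Members of a packing are edge-disjoint, so a fingerprint of edges corresponds to equally many
   members. *)
have y_inj : {in S &, injective y}.
  move=> f g fS gS yfg; apply/eqP; apply: contraT => fg.
  have /disjoint_setI0/setP/(_ (inl (y f))) := Sp f g fS gS fg.
  rewrite inE !mem_sset_inl inE.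
  have /and3P[ef _ _] := mkP f fS; have /and3P[eg _ _] := mkP g gS.
  by rewrite {1}/y imset_f // yfg {1}/y imset_f.
pose X i := [set y f | f in S & (mk f).2 == i].
have XG i (e : {set 'I_n}) : e \in X i -> e \in edges G /\ c e = i.
  move=> /imsetP[f]; rewrite inE => /andP[fS /eqP <-] ->.
  by have /and3P[ef /eqP <- _] := mkP f fS; split=> //; exact: SG.
have X0 i := nocopies i (X i) (XG i).
have X2 i e : e \in X i -> #|e| = 2%N by move=> /XG[/edges2].
have TX i : T i (X i) \subset X i by have [+ _] := TC i; apply.
pose A : {set {ffun V i0 -> 'I_n} * mark} :=
  [set (f, mk f) | f in S & y f \in T (mk f).2 (X (mk f).2)].
have AE i : marked_edges A i = T i (X i).
  apply/setP => e; apply/imsetP/idP => [[x]|eT].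
    rewrite inE => /andP[/imsetP[f]]; rewrite inE => /andP[fS yT] -> /= /eqP <- ->.
    exact: yT.
  have /imsetP[f] := subsetP (TX i) e eT; rewrite inE => /andP[fS /eqP fi] ey.
  exists (f, mk f) => //; rewrite inE /= fi eqxx andbT.
  by apply/imsetP; exists f; rewrite // inE fS fi -ey.
(* The container of [X i] can be recomputed from the marked edges alone, as these are the
   fingerprint of [X i]. *)
have CE i : C i (marked_edges A i) = C i (X i).
  rewrite AE; have [_ H] := TC i.
  by have [_ ->] := H (X i) (T i (X i)) (subxx _) (TX i).
have mk0 f : f \in S -> (mk f).2 != i0 by move=> /mkP/and3P[].
apply/existsP; exists A; apply/existsP; exists S.
apply/and5P; split=> //; last (apply/andP; split; last by rewrite cS).
- rewrite -ltnS -(ltr_nat R); apply: le_lt_trans bt0.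
  apply: (@le_trans _ _ (\sum_(i | i != i0) #|T i (X i)|%:R)); last first.
    by apply: ler_sum => i ii0; have [] := TCb ii0 (X2 i) (X0 i).
  rewrite -natr_sum ler_nat.
  rewrite -sum1_card (partition_big (fun x => x.2.2) (fun i => i != i0)) /=; last first.
    by move=> x /imsetP[f]; rewrite inE => /andP[fS _] -> /=; exact: mk0.
  apply: leq_sum => i _; rewrite -AE sum1_card /marked_edges card_in_imset.
    by apply: subset_leq_card; apply/subsetP => x; rewrite unfold_in inE.
  move=> x1 x2; rewrite !inE => /andP[/imsetP[f fA ->] _] /andP[/imsetP[g gA ->] _] /= e.
  rewrite !inE in fA gA; have /andP[fS _] := fA; have /andP[gS _] := gA.
  by rewrite (y_inj f g fS gS e).
- by apply/dinjectiveP => x1 x2 /imsetP[f _ ->] /imsetP[g _ ->] /= ->.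
- by apply/subsetP => _ /imsetP[x /imsetP[f fA ->] ->]; move: fA; rewrite inE => /andP[].
- apply/subsetP => f fS; rewrite inE (subsetP SB f fS) /=.
  have /and3P[ef _ m0] := mkP f fS.
  apply/existsP; exists (mk f).2; rewrite m0 CE /=.
  apply/existsP; exists (mk f).1; rewrite ef /=.
  have [_ /subsetP] := TCb m0 (X2 _) (X0 (mk f).2); apply.
  by apply/imsetP; exists f; rewrite // inE fS eqxx.
Qed.

End Failure.

(** This is where the asymmetric density enters: with [m] equal to it, every subgraph of [F_1] with
    an edge has, up to constants, at least [kappa ^+ 2 * n ^ (2 - theta)] expected copies. *)
Lemma copies_lower_bound (R : realType) (S : finType) (E : {set {set S}})
    (theta m kappa p : R) (n : nat) (E' : {set {set S}}) :
  0 < m -> 1 <= kappa -> (0 < n)%N -> E' != set0 ->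
  #|E'|%:R <= m * (#|cover E'|%:R - 2 + theta) ->
  kappa ^+ 2 * (n%:R `^ (- (1 / m))) <= p ->
  kappa ^+ 2 * (n%:R ^+ 2 * n%:R `^ (- theta)) <= n%:R ^+ #|cover E'| * p ^+ #|E'|.
Proof.
move=> m0 k1 n0 E'0 Em pK.
have nR : 0 < n%:R :> R by rewrite ltr0n.
have n1 : 1 <= n%:R :> R by rewrite ler1n.
have k21 : 1 <= kappa ^+ 2 by rewrite expr2; nra.
have k2p : 0 < kappa ^+ 2 by apply: lt_le_trans k21.
have pw0 x : 0 < n%:R `^ x :> R by exact: powR_gt0.
apply: (@le_trans _ _ (n%:R ^+ #|cover E'| * (kappa ^+ 2 * n%:R `^ (- (1 / m))) ^+ #|E'|)); last first.
  rewrite ler_wpM2l ?exprn_ge0 // lerXn2r ?nnegrE //.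
    by rewrite mulr_ge0 // ltW.
  by apply: le_trans pK; rewrite mulr_ge0 // ltW.
rewrite exprMn [leRHS]mulrCA; apply: ler_pM.
- exact: ltW.
- by rewrite mulr_ge0 ?exprn_ge0 // ltW.
- by rewrite -[leLHS]expr1 ler_weXn2l // card_gt0.
rewrite -(powR_mulrn _ (ltW (pw0 _))) -powRrM.
rewrite -!(powR_mulrn _ (ltW nR)) -!powRDpos //; apply: ler_powR => //.
have : #|E'|%:R / m <= #|cover E'|%:R - 2 + theta by rewrite ler_pdivrMr // mulrC.
have -> : - (1 / m) * #|E'|%:R = - (#|E'|%:R / m) by field; rewrite gt_eqF.
lra.
Qed.

(** * Choice of the parameters and the probability estimate *)

Section Main.
Variables (R : realType) (r : nat) (V : 'I_r -> finType).
Variables (F : forall i : 'I_r, sgraph (V i)) (i0 : 'I_r).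
Hypothesis hF : forall i, has_edge (F i).

(** No bad embedding has all its edges outside the containers, and supersaturation provides many
    embeddings that do. *)
Lemma card_bad_le (n : nat) (C : 'I_r -> {set {set 'I_n}} -> {set {set 'I_n}})
    (zeta : R) (A : {set {ffun V i0 -> 'I_n} * mark V i0}) :
  0 <= zeta ->
  zeta * n%:R ^+ #|V i0| <= #|copies (edges (F i0))
    [set e | [forall i, (i != i0) ==> (e \notin C i (marked_edges A i))]]|%:R ->
  #|bad F C A|%:R <= (1 - zeta) * #|embeddings n (V i0)|%:R.
Proof.
move=> z0; set good := copies _ _ => Hgood.
have cB : (#|embeddings n (V i0)| <= n ^ #|V i0|)%N.
  by apply: leq_trans (max_card _) _; rewrite card_ffun card_ord.
have : (#|bad F C A| + #|good| <= #|embeddings n (V i0)|)%N.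
  have <- : #|bad F C A :|: good| = (#|bad F C A| + #|good|)%N.
    rewrite cardsU disjoint_setI0 ?cards0 ?subn0 // -setI_eq0; apply/eqP/setP => f.
    rewrite !inE; apply/negP => /andP[/andP[_ /existsP[i /andP[ii0 /existsP[e /andP[eE eC]]]]]].
    move=> /andP[_ /forall_inP/(_ e eE)]; rewrite inE => /forallP/(_ i).
    by rewrite ii0 eC.
  apply: subset_leq_card; apply/subsetP => f /setUP[]; first by rewrite inE => /andP[].
  by rewrite !inE => /andP[].
rewrite -(ler_nat R) natrD => H.
move: cB; rewrite -(ler_nat R) natrX => cB.
have : zeta * #|embeddings n (V i0)|%:R <= zeta * n%:R ^+ #|V i0| by rewrite ler_wpM2l.
lra.
Qed.

(** A quantitative form of the theorem: both failure probabilities are of order [1 / mu], and [mu]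
    is at least [n / cB]. *)
Lemma arrows_likely (theta m : R) : 0 < theta <= 1 -> 0 < m ->
  (forall i (E' : {set {set V i}}), i != i0 -> E' \subset edges (F i) -> E' != set0 ->
     theta * (#|E'|%:R - 1) <= #|cover E'|%:R - 2) ->
  (forall E' : {set {set V i0}}, E' \subset edges (F i0) -> E' != set0 ->
     #|E'|%:R <= m * (#|cover E'|%:R - 2 + theta)) ->
  exists K c : R, exists n0 : nat, [/\ 0 < K, 0 < c, (0 < n0)%N & forall n p, (n0 <= n)%N ->
    0 <= p <= 1 -> K * n%:R `^ (- (1 / m)) <= p ->
    1 - c / n%:R <= gnp_prob p (fun G : sgraph 'I_n => arrows G F)].
Proof.
move=> /andP[th0 th1] m0 Hth Hm.
have E2 i e : e \in edges (F i) -> #|e| = 2%N by exact: edges2.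
have [eps [zeta0 [n1 [eps0 z00 Hsup]]]] := supersaturation R E2 i0.
pose zeta := Num.min zeta0 1.
have z0 : 0 < zeta by rewrite lt_min z00 ltr01.
have z1 : zeta <= 1 by rewrite ge_min lexx orbT.
have zz0 : zeta <= zeta0 by rewrite ge_min lexx.
have /fin_all_exists[Kc HKc] i : exists Kc : R, 0 < Kc /\ forall n, (0 < n)%N ->
    exists TC : ({set {set 'I_n}} -> {set {set 'I_n}}) * ({set {set 'I_n}} -> {set {set 'I_n}}),
    fingerprint TC.1 TC.2 /\ (i != i0 ->
    (forall I : {set {set 'I_n}}, (forall e, e \in I -> #|e| = 2%N) ->
       copies (edges (F i)) I = set0 ->
       #|TC.1 I|%:R <= Kc * (n%:R ^+ 2 * n%:R `^ (- theta)) /\ I \subset TC.2 I) /\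
    (forall I, #|copies (edges (F i)) (TC.2 I)|%:R <= eps * n%:R ^+ #|V i|)).
  have [->|ii0] := eqVneq i i0.
    exists 1; split=> // n _; exists (fun=> set0, fun=> set0); split=> //.
    exact: fingerprint_cst.
  have [|Kc Kc0 HKc] := copies_containers (theta := theta) (hF i) (@E2 i) _ (fun E' => Hth i E' ii0) eps0.
    by rewrite th1 ltW.
  exists Kc; split=> // n n0; have [T [C [fp [H1 H2]]]] := HKc n n0.
  by exists (T, C).
pose mm := #|{: mark V i0}|.
have mm0 : (0 < mm)%N by apply/card_gt0P; exists (set0, i0).
have z01 : 0 < zeta <= 1 by rewrite z0 z1.
have [beta b0 [c9 c90 H9]] := first_moment_numerics mm0 z01.
pose v := #|V i0|; pose e1 := #|edges (F i0)|.
pose c1 : R := #|{set {set V i0}}|%:R * v%:R ^+ v.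
pose cB : R := 2 ^+ v.
have cB0 : 0 < cB by rewrite exprn_gt0.
have cBE : cB = 2 ^+ v by [].
have c1E : c1 = #|{set {set V i0}}|%:R * v%:R ^+ v by [].
pose sK : R := \sum_(i | i != i0) Kc i.
have sK0 : 0 <= sK by apply: sumr_ge0 => i _; rewrite ltW //; have [] := HKc i.
have c10 : 0 <= c1 by rewrite mulr_ge0 // exprn_ge0.
clearbody c1 cB.
(* Three demands on [kappa]: [x1] makes intersecting pairs rare, [x2] keeps the fingerprints below
   [beta * mu], and [x3] ensures [1 <= e * mu]. *)
pose x1 := 32 * c1 / zeta; pose x2 := sK * cB / beta; pose x3 := 16 * cB / zeta.
have x10 : 0 <= x1 by rewrite divr_ge0 ?(ltW z0) // mulr_ge0.
have x20 : 0 <= x2 by rewrite divr_ge0 ?(ltW b0) // mulr_ge0 // ltW.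
have x30 : 0 <= x3 by rewrite divr_ge0 ?(ltW z0) // mulr_ge0 // ltW.
pose kappa : R := 1 + x1 + x2 + x3.
have k1 : 1 <= kappa by rewrite /kappa; lra.
have kx1 : x1 <= kappa by rewrite /kappa; lra.
have kx2 : x2 <= kappa by rewrite /kappa; lra.
have kx3 : x3 <= kappa by rewrite /kappa; lra.
clearbody kappa.
have k0 : 0 < kappa by lra.
(* Half of the loss [zeta / 8] allowed for [k]; the other half covers the rounding of [k]. *)
pose e : R := zeta / 16.
have e0 : 0 < e by rewrite divr_gt0.
pose c' := c9 + 4 * e1.+1%:R / e ^+ 2.
have c'0 : 0 < c' by rewrite addr_gt0 // divr_gt0 ?exprn_gt0 // mulr_gt0 // ltr0n.
exists (kappa ^+ 2), (c' * cB), (maxn 1 (maxn n1 v.*2)).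
split; rewrite ?exprn_gt0 ?mulr_gt0 //; first by rewrite leq_maxl.
move=> n p; rewrite !geq_max => /and3P[n0 nn1 nv] p01 pK.
have nR : 0 < n%:R :> R by rewrite ltr0n.
have n1R : 1 <= n%:R :> R by rewrite ler1n.
pose N : R := n%:R ^+ 2 * n%:R `^ (- theta).
have NE : N = n%:R ^+ 2 * n%:R `^ (- theta) by [].
have Nn : n%:R <= N.
  rewrite /N -(powR_mulrn _ (ltW nR)) -powRDpos // -[leLHS](powRr1 (ltW nR)).
  apply: ler_powR => //; lra.
have N0 : 0 < N by apply: lt_le_trans Nn.
clearbody N.
have p0 : 0 < p by apply: lt_le_trans pK; rewrite mulr_gt0 ?exprn_gt0 ?powR_gt0.
have p1 : p <= 1 by have /andP[] := p01.
have key (E' : {set {set V i0}}) : E' \subset edges (F i0) -> E' != set0 ->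
    kappa ^+ 2 * N <= n%:R ^+ #|cover E'| * p ^+ #|E'|.
  by move=> E'E E'0; rewrite NE; apply: copies_lower_bound (Hm E' E'E E'0) pK.
have den0 : 0 < n%:R ^+ v * p ^+ e1 by rewrite mulr_gt0 // exprn_gt0.
(* Chosen so that [mu] is [kappa * N] up to a constant. Only one of the two factors [kappa] in [key]
   is spent here; the other makes the kept copies mostly edge-disjoint. *)
pose q := kappa * N / (n%:R ^+ v * p ^+ e1).
have q0 : 0 < q by rewrite divr_gt0 // mulr_gt0.
have q01 : 0 <= q <= 1.
  rewrite (ltW q0) /= ler_pdivrMr // mul1r.
  apply: le_trans (_ : kappa ^+ 2 * N <= _).
    by rewrite ler_pM2r // expr2 ler_peMl // ltW.
  apply: le_trans (key _ (subxx _) (hF i0)) _.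
  by rewrite ler_wpM2r ?exprn_ge0 ?(ltW p0) // ler_weXn2l // max_card.
pose wq := @space_weight R n (V i0) p q.
have wq01 := @space_weight01 R n (V i0) p q p01 q01.
pose sp := @embedding_supp n (V i0) (edges (F i0)).
pose B := embeddings n (V i0).
pose mu := mean wq sp B.
have muE : mu = #|B|%:R * (p ^+ e1 * q) by apply: mean_embeddings; exact: E2.
have pq : p ^+ e1 * q = kappa * N / n%:R ^+ v.
  by rewrite mulrC /q invfM mulrA divfK // gt_eqF // exprn_gt0.
have mu_ge : kappa * N / cB <= mu.
  have := expn_le_ffact nv; rewrite -(ler_nat R) natrM !natrX => H.
  have BE : #|B| = (n ^_ v)%N by rewrite /B /embeddings card_inj_ffuns card_ord.
  rewrite muE pq BE ler_pdivrMr //.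
  have -> : (n ^_ v)%:R * (kappa * N / n%:R ^+ v) * cB =
     kappa * N * ((cB * (n ^_ v)%:R) / n%:R ^+ v).
    by move: (_ ^-1) (_%:R) => a b'; ring.
  rewrite ler_peMr ?(ltW (mulr_gt0 k0 N0)) //.
  by rewrite ler_pdivlMr ?exprn_gt0 // mul1r cBE.
have kN1 : 1 <= N by apply: le_trans Nn.
have mu0 : 0 < mu by apply: lt_le_trans mu_ge; rewrite divr_gt0 // mulr_gt0.
have mu_n : n%:R <= cB * mu.
  rewrite mulrC -ler_pdivrMr //; apply: le_trans mu_ge.
  by rewrite ler_pM2r ?invr_gt0 //; apply: le_trans Nn _; rewrite ler_peMl // ltW.
have mu16 : 1 <= e * mu.
  apply: (@le_trans _ _ (e * (x3 / cB))).
    by rewrite /e /x3 le_eqVlt; apply/orP; left; apply/eqP; field; rewrite ?gt_eqF.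
  rewrite ler_pM2l //; apply: le_trans mu_ge; rewrite ler_pM2r ?invr_gt0 //.
  by apply: le_trans kx3 _; rewrite ler_peMr // ltW.
have sKN : sK * N <= beta * mu.
  apply: (@le_trans _ _ (beta * (x2 * N / cB))).
    by rewrite /x2 le_eqVlt; apply/orP; left; apply/eqP; field; rewrite ?gt_eqF.
  rewrite ler_pM2l //; apply: le_trans mu_ge; by rewrite ler_pM2r ?invr_gt0 // ler_pM2r.
have tail : expect wq (fun W => ((nu sp B W)%:R < (1 - e) * mu)%R%:R) <= 4 * e1.+1%:R / (e ^+ 2 * mu).
  apply: nu_lower_tail => //.
  - by move=> f fB; exact: card_supp.
  (* The expression to be bounded equals [kappa * N / (n ^ #|cover E'| * p ^ #|E'|)], which is at
     most [kappa^-1] by [key]. *)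
  have := sum_meets_le p01 q01 (@E2 i0) (d := kappa^-1).
  rewrite invr_ge0 (ltW k0) => /(_ n isT) H.
  apply: le_trans (H _) _.
    move=> E' E'E E'0; have cv : (#|cover E'| <= v)%N by exact: max_card.
    have ce : (#|E'| <= e1)%N by exact: subset_leq_card.
    have Hkey := key E' E'E E'0.
    have -> : q * n%:R ^+ (v - #|cover E'|) * p ^+ (e1 - #|E'|) =
       kappa * N / (n%:R ^+ #|cover E'| * p ^+ #|E'|).
      have nE : n%:R ^+ v = n%:R ^+ (v - #|cover E'|) * n%:R ^+ #|cover E'| :> R.
        by rewrite -exprD subnK.
      have pE : p ^+ e1 = p ^+ (e1 - #|E'|) * p ^+ #|E'| by rewrite -exprD subnK.
      rewrite /q nE pE.
      have := exprn_gt0 (v - #|cover E'|) nR; have := exprn_gt0 (e1 - #|E'|) p0.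
      have := exprn_gt0 #|cover E'| nR; have := exprn_gt0 #|E'| p0.
      move: (p ^+ _) (p ^+ _) (n%:R ^+ _) (n%:R ^+ _) => a1 a2 a3 a4 *.
      by field; rewrite ?gt_eqF.
    rewrite ler_pdivrMr; last by rewrite mulr_gt0 // exprn_gt0.
    by rewrite [leRHS]mulrC ler_pdivlMr // mulrC mulrA -expr2.
  rewrite ler_wpM2r ?(ltW mu0) // -/v -c1E ler_pdivrMr //.
  have -> : c1 = e / 2 * x1 by rewrite /e /x1; field; rewrite gt_eqF.
  by rewrite ler_wpM2l // divr_ge0 // ltW.
pose t0 := Num.trunc (beta * mu); pose k := Num.trunc ((1 - e) * mu).
have e11 : e <= 1 by rewrite ler_pdivrMr // mul1r (le_trans z1) // ler1n.
have bm0 : 0 <= beta * mu by rewrite mulr_ge0 // ltW.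
have em0 : 0 <= (1 - e) * mu by rewrite mulr_ge0 ?(ltW mu0) // subr_ge0.
have kge : (1 - zeta / 8) * mu <= k%:R.
  have : (1 - e) * mu < k%:R + 1 by rewrite natr1; exact: truncnS_gt.
  have -> : zeta / 8 = e + e by rewrite /e; field.
  by clear - mu16; lra.
have t0le : t0%:R <= beta * mu by rewrite truncn_le.
have [k' tk Hk'] := H9 mu t0 k mu0 t0le kge.
have /fin_all_exists[TC HTC] i := (HKc i).2 n n0.
pose T i := (TC i).1; pose C i := (TC i).2.
have fpTC i : fingerprint (T i) (C i) by have [] := HTC i.
have TCb i (I : {set {set 'I_n}}) : i != i0 ->
    (forall e, e \in I -> #|e| = 2%N) -> copies (edges (F i)) I = set0 ->
    #|T i I|%:R <= Kc i * N /\ I \subset C i I.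
  by move=> ii0; have [_ /(_ ii0)[H _]] := HTC i; rewrite NE; exact: H.
have bt0 : \sum_(i | i != i0) Kc i * N < t0.+1%:R.
  by rewrite -mulr_suml; apply: le_lt_trans sKN _; exact: truncnS_gt.
have lam0 : 0 <= (1 - zeta) * mu by rewrite mulr_ge0 ?(ltW mu0) // subr_ge0.
have marked : expect wq (fun W => (marked_event sp B (bad F C) t0 k W)%:R) <= c9 / mu.
  apply: Hk'; apply: marked_first_moment => // A.
  rewrite (eq_bigr (fun=> p ^+ e1 * q)) => [|f]; last first.
    by rewrite inE => /andP[fB _]; apply: weight_supp => //; exact: E2.
  rewrite sumr_const -[_ *+ _]mulr_natl muE [leRHS]mulrA ler_wpM2r //.
    by rewrite mulr_ge0 ?exprn_ge0 ?(ltW q0) ?(ltW p0).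
  apply: card_bad_le; first exact: ltW.
  apply: le_trans (_ : zeta0 * n%:R ^+ #|V i0| <= _).
    by rewrite ler_wpM2r ?exprn_ge0.
  apply: (Hsup n nn1 (fun i => C i (marked_edges A i))) => i ii0.
  by have [_ /(_ ii0)[_ H]] := HTC i; exact: H.
have union : 1 - gnp_prob p (fun G : sgraph 'I_n => arrows G F) <= c9 / mu + 4 * e1.+1%:R / (e ^+ 2 * mu).
  have -> : 1 - gnp_prob p (fun G : sgraph 'I_n => arrows G F) =
      expect wq (fun W => 1 - (arrows (graph_part W) F)%:R).
    by rewrite expectB expect_cst (gnp_probE (V i0) p q).
  apply: le_trans (lerD marked tail); rewrite -expectD; apply: le_expect => // W.
  have [aW|naW] := boolP (arrows _ F); first by rewrite subrr addr_ge0.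
  rewrite subr0; have [_|kW] := ltP _ ((1 - e) * mu); first by rewrite lerDr.
  rewrite (failure_marked fpTC TCb bt0 naW) ?lerDl //.
  by rewrite -(ler_nat R) (le_trans _ kW) // truncn_le.
have : c9 / mu + 4 * e1.+1%:R / (e ^+ 2 * mu) = c' / mu.
  by rewrite /c'; field; rewrite ?gt_eqF.
move=> H; rewrite H in union.
have : c' / mu <= c' * cB / n%:R.
  by rewrite -mulrA ler_pM2l // ler_pdivlMr // mulrC ler_pdivrMr.
by move: union; clear; lra.
Qed.

End Main.

Lemma gnp_prob_le1 (R : realType) (n : nat) (p : R) (A : pred (sgraph 'I_n)) :
  0 <= p <= 1 -> gnp_prob p A <= 1.
Proof.
move=> p01; have q01 : 0 <= (0 : R) <= 1
  by rewrite lexx ler01.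
rewrite (@gnp_probE R n 'I_0 p 0) -[leRHS](expect_cst (@space_weight R n 'I_0 p 0) 1).
by apply: le_expect => [|W]; [exact: space_weight01 | case: (A _)].
Qed.

From mathcomp Require Import all_classical all_reals all_analysis.

Import Order.TTheory GRing.Theory Num.Theory.
Import numFieldNormedType.Exports.
Local Open Scope classical_set_scope.
Local Open Scope ring_scope.

Theorem theorem2p1 (R : realType) (r : nat) (hr : (1 < r)%N)
    (V : 'I_r -> finType) (F : forall i : 'I_r, sgraph (V i))
    (F1 := F (Ordinal (ltnW hr))) (F2 := F (Ordinal hr))
    (hF : forall i : 'I_r, has_edge (F i))
    (hm2 : forall i j : 'I_r, (i <= j)%N -> m2 R (F j) <= m2 R (F i))
    (hF2 : 1 <= m2 R F2) :
  exists K : R, 0 < K /\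
    forall p : nat -> R,
      (forall n, 0 <= p n <= 1) ->
      (\forall n \near \oo, K * (n%:R `^ (- (1 / m2asym R F1 F2))) <= p n) ->
      gnp_prob (p n) (fun G : sgraph 'I_n => arrows G F) @[n --> \oo] --> (1 : R).
Proof.
have m20 : 0 < m2 R F2 by apply: lt_le_trans hF2.
pose theta : R := 1 / m2 R F2.
have th0 : 0 < theta by rewrite divr_gt0.
have th01 : 0 < theta <= 1 by rewrite th0 ler_pdivrMr // mul1r.
have Hm := fun E' EF E0 => @edges_le_m2asym _ R _ F1 F2 E' EF E0 m20.
have m0 : 0 < m2asym R F1 F2.
  have := Hm _ (subxx _) (hF _); have := cover_ge2 (subxx _) (hF (Ordinal (ltnW hr))).
  rewrite -(ler_nat R) => c2 H.
  have e1 : (1 : R) <= #|edges F1|%:R by rewrite ler1n card_gt0; exact: hF.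
  have : 0 < m2asym R F1 F2 * (#|finset.cover (edges F1)|%:R - 2 + theta).
    by apply: lt_le_trans H; apply: lt_le_trans e1.
  by rewrite pmulr_lgt0 // ltr_wpDl // subr_ge0.
(* An index other than 0 is at least 1, so by monotonicity [m2 R (F i) <= m2 R F2], and one [theta]
   serves all these colours. *)
have Hth (i : 'I_r) (E' : {set {set V i}}) : i != Ordinal (ltnW hr) ->
    E' \subset edges (F i) -> E' != finset.set0 ->
    theta * (#|E'|%:R - 1) <= #|finset.cover E'|%:R - 2.
  move=> i0 EF E0; have c2 : 0 <= #|finset.cover E'|%:R - 2 :> R.
    by rewrite subr_ge0 ler_nat; exact: cover_ge2 EF E0.
  rewrite mulrC /theta mulrA mulr1 ler_pdivrMr // mulrC.
  apply: le_trans (edges_le_m2 R EF E0) _; rewrite ler_wpM2r //; apply: hm2.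
  by rewrite lt0n; apply: contra i0 => /eqP i0; apply/eqP/val_inj.
have [K [c [n0 [K0 c0 n00 H]]]] := arrows_likely hF th01 m0 Hth Hm.
exists K; split=> // p p01 pK; apply/cvgrPdist_le => eps eps0.
near=> n.
have n_gt0 : 0 < n%:R :> R by rewrite ltr0n (leq_trans n00) //; near: n; exact: nbhs_infty_ge.
rewrite ger0_norm; last by rewrite subr_ge0 gnp_prob_le1.
(* The failure probability is at most [c / n], which tends to 0. *)
apply: le_trans (_ : c / n%:R <= _).
  rewrite lerBlDl -lerBlDr; apply: H => //; last by near: n.
  by near: n; exact: nbhs_infty_ge.
rewrite ler_pdivrMr // mulrC -ler_pdivrMr //.
by near: n; exact: nbhs_infty_ger.
Unshelve. all: by end_near.
Qed.
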